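(* Let $p>2$ be an odd prime number, $G$ a transitive group of degree $p^{2}$, and $H$ a corresponding subgroup of $G$. We further assume that $G$ is a $p$-group. (i) If $\text{Ш}_{\omega}^{2}(G,J_{G/H})\neq 0$, then we have $G\cong P'_{n}$ for some $n\in \{1,2\}$. (ii) Assume $G\cong P'_{n}$ for some $n\in \{1,2\}$. For an admissible set $\mathcal{D}$ of subgroups in $G$, there is an isomorphism \[ \text{Ш}_{\mathcal{D}}^{2}(G,J_{G/H})\cong \begin{cases} 0&\text{if $(C_{p})^{2}<D$ for some $D\in \mathcal{D}$;}\\ \mathbb{Z}/p&\text{otherwise.} \end{cases} \]
   Context: A transitive group of degree $n$ is a subgroup $G\le\mathfrak{S}_n$ acting transitively on $\mathbb{Z}/n$; a corresponding subgroup is $G\cap\mathrm{Stab}_{\mathfrak{S}_n}(i)$. Identify $\mathbb{Z}/p^2$ with $\mathbb{F}_p\times\mathbb{F}_p$ via $a+pb\mapsto(a,b)$. Let $\rho_1(i,j)=(i,j+1)$, $\rho_2(i,j)=(i+1,j)$, $z_{i_0}(i,j)=(i_0,j+1)$ if $i=i_0$ and $(i,j)$ otherwise, and $\gamma_n=\prod_{j=0}^{p-1}z_j^{a_{p-n,j}}$ with $a_{i,j}=(-1)^{i-j}\binom{i}{j}$ for $i\ge j$ and $0$ otherwise. Put $P'_n:=\langle\rho_1,\rho_2,\gamma_n\rangle\le\mathfrak{S}_{p^2}$; thus $P'_1\cong(C_p)^2$ (regular) and $P'_2$ is the nonabelian group of order $p^3$ and exponent $p$. $J_{G/H}$ is defined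 by $0\to\mathbb{Z}\to\operatorname{Ind}_H^G\mathbb{Z}\to J_{G/H}\to0$. For a $G$-module $M$ and a set $\mathcal{D}$ of subgroups, $\text{Ш}^2_{\mathcal{D}}(G,M):=\ker\big(H^2(G,M)\to\bigoplus_{D\in\mathcal{D}}H^2(D,M)\big)$, $\text{Ш}^2_\omega:=\text{Ш}^2_{\mathcal{C}_G}$ with $\mathcal{C}_G$ the set of cyclic subgroups; $\mathcal{D}$ is admissible if it contains $\mathcal{C}_G$ and is closed under conjugation. *)

(* Defs.v *)
From mathcomp Require Import all_boot all_order all_algebra all_fingroup all_solvable.
Set Implicit Arguments. Unset Strict Implicit. Unset Printing Implicit Defensive.
Import GRing.Theory.
Local Open Scope ring_scope.
Local Open Scope group_scope.

Section PPrime.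
Variable p : nat.
Local Notation X := ('F_p * 'F_p)%type.

Definition shift_fun (b : 'F_p -> 'F_p) (x : X) : X := (x.1, (x.2 + b x.1)%R).
Lemma shift_inj b : injective (shift_fun b).
Proof.
move=> [i j] [i' j'] /(congr1 (fun x : X => (x.1, (x.2 - b x.1)%R))).
by rewrite /shift_fun /= !addrK.
Qed.
Definition shiftp b : {perm X} := perm (@shift_inj b).

Definition rho1_fun (x : X) : X := (x.1, (x.2 + 1)%R).
Lemma rho1_inj : injective rho1_fun.
Proof.
move=> [i j] [i' j'] /(congr1 (fun x : X => (x.1, (x.2 - 1)%R))).
by rewrite /rho1_fun /= !addrK.
Qed.
Definition rho1 : {perm X} := perm rho1_inj.

Definition rho2_fun (x : X) : X := ((x.1 + 1)%R, x.2).
Lemma rho2_inj : injective rho2_fun.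
Proof.
move=> [i j] [i' j'] /(congr1 (fun x : X => ((x.1 - 1)%R, x.2))).
by rewrite /rho2_fun /= !addrK.
Qed.
Definition rho2 : {perm X} := perm rho2_inj.

Definition z_fun (i0 : 'F_p) (x : X) : X :=
  if x.1 == i0 then (x.1, (x.2 + 1)%R) else x.
Lemma z_inj i0 : injective (z_fun i0).
Proof.
move=> [i j] [i' j']; rewrite /z_fun /=.
case: (eqVneq i i0) => [->|ni]; case: (eqVneq i' i0) => [->|ni'] //=.
- move/(congr1 (fun x : X => (x.2 - 1)%R)); rewrite /= !addrK => ->; done.
- by case=> E _; rewrite E eqxx in ni'.
- by case=> E _; rewrite -E eqxx in ni.
Qed.
Definition z (i0 : 'F_p) : {perm X} := perm (@z_inj i0).

Definition zpowp (s : {perm X}) (a : int) : {perm X} :=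
  match a with
  | Posz n => s ^+ n
  | Negz n => (s ^-1) ^+ n.+1
  end.

Definition acoef (i j : nat) : int :=
  if (j <= i)%N then ((-1) ^+ (i - j) * ('C(i, j))%:Z)%R else 0%R.

(* gamma_n = prod_{j=0}^{p-1} z_j^{a_{p-n,j}} ; the z_j commute *)
Definition gammap (n : nat) : {perm X} :=
  \prod_(j < p) zpowp (z (j%:R)%R) (acoef (p - n) j).

Definition Pprime (n : nat) : {group {perm X}} :=
  <<[set rho1; rho2; gammap n]>>%G.
End PPrime.

Section Cohomology.
Variable gT : finGroupType.
Variables G H : {group gT}.

(* Ind_H^G Z = Z[G/H] is represented by integer functions on (right) cosets of H
   in G; only the values on [rcosets H G] matter.  The augmentation-dual map
   Z -> Z[G/H] sends 1 to the sum of all cosets, i.e. the constant function 1,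
   so J_{G/H} = Z[G/H] / (constants). *)
Definition Jel := {set gT} -> int.

Definition Jeq (m1 m2 : Jel) : Prop :=
  exists c : int, forall C, C \in rcosets H G -> (m1 C - m2 C)%R = c.

(* left G-action: (g.m)(Hx) = m(Hxg) *)
Definition Jact (g : gT) (m : Jel) : Jel := fun C => m (C :* g).

Definition Jadd (m1 m2 : Jel) : Jel := fun C => (m1 C + m2 C)%R.
Definition Jsub (m1 m2 : Jel) : Jel := fun C => (m1 C - m2 C)%R.
Definition J0 : Jel := fun _ => 0%R.

Definition cochain2 := gT -> gT -> Jel.
Definition cochain1 := gT -> Jel.

Definition cochain2_add (f1 f2 : cochain2) : cochain2 :=
  fun g h => Jadd (f1 g h) (f2 g h).

Definition cocycle2 (D : {set gT}) (f : cochain2) : Prop :=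
  forall g h k, g \in D -> h \in D -> k \in D ->
    Jeq (Jadd (Jsub (Jact g (f h k)) (f (g * h) k)) (Jsub (f g (h * k)) (f g h))) J0.

Definition coboundary2 (D : {set gT}) (f : cochain2) : Prop :=
  exists c : cochain1, forall g h, g \in D -> h \in D ->
    Jeq (f g h) (Jadd (Jsub (Jact g (c h)) (c (g * h))) (c g)).

Definition sha_cocycle (Dset : {set {group gT}}) (f : cochain2) : Prop :=
  cocycle2 G f /\ forall D : {group gT}, D \in Dset -> coboundary2 D f.

Definition sha_trivial (Dset : {set {group gT}}) : Prop :=
  forall f, sha_cocycle Dset f -> coboundary2 G f.

(* Sha^2_Dset(G, J_{G/H}) ~= Z/p : a surjective additive map from the group of
   Sha-cocycles onto Z/p whose kernel is exactly the coboundaries *)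
Definition sha_iso_Zp (p : nat) (Dset : {set {group gT}}) : Prop :=
  exists phi : cochain2 -> 'Z_p,
    [/\ forall f1 f2, sha_cocycle Dset f1 -> sha_cocycle Dset f2 ->
          phi (cochain2_add f1 f2) = (phi f1 + phi f2)%R,
        forall a : 'Z_p, exists2 f, sha_cocycle Dset f & phi f = a
      & forall f, sha_cocycle Dset f -> (phi f = 0%R <-> coboundary2 G f)].

Definition cyclic_subgroups : {set {group gT}} :=
  [set D : {group gT} | (D \subset G) && cyclic D].

Definition admissible (Dset : {set {group gT}}) : Prop :=
  [/\ forall D : {group gT}, D \in Dset -> D \subset G,
      cyclic_subgroups \subset Dset
    & forall (D : {group gT}) g, D \in Dset -> g \in G -> (D :^ g)%G \in Dset].
End Cohomology.

(* Main.v *)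
Require Import Defs.
From mathcomp Require Import all_boot all_order all_algebra all_fingroup all_solvable.
From mathcomp Require Import ring lra.
Set Implicit Arguments. Unset Strict Implicit. Unset Printing Implicit Defensive.
Import GRing.Theory Num.Theory.
Local Open Scope group_scope.
Local Open Scope ring_scope.

(* Dimension shifting gives H^2(G, J_{G/H}) = H^1(G, J_{G/H} (x) Q/Z), and J (x) Q/Z
   consists of the functions X -> Q/Z modulo constants, X = G/H.  Let z be a central
   element of order p: it acts freely, and the stabilizer V of all its orbits (the
   fibres) has index p in G, say G = V<t>.  A 1-cocycle m can be normalized so that
   m_z = 0; then m_g(z x) - m_g(x) is a constant theta(g), and theta : G -> (1/p)Z/Z is
   a homomorphism.  Local triviality on cyclic subgroups says that m_h takes a single
   value on the fixed points of h, so theta kills V and is determined by theta(t).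
   If theta(t) = 0 the class is trivial.  If theta(t) <> 0, then G has exponent p, and
   an element of V, seen as a function on the p fibres, vanishes as soon as it vanishes
   on two consecutive ones; hence |G| is p^2 or p^3 and G is P'_1 or P'_2.  For these
   groups an explicit quadratic cocycle realizes every value of theta(t), and
   restriction to an elementary abelian subgroup of order p^2 detects it. *)

(** Q/Z is never formed: each identity is a congruence between rationals, proved by writing a
    quantity as a sum of known integers ([int_eq], then [ring]). Conjugation by [t] translates the
    function [e v] on fibres by one, so knowledge of two adjacent fibres spreads to all. If theta
    vanishes, then on V the function [m v] depends only on the fibre and is, up to a constant, one
    fixed multiple [r] of [e v]; so [r * j] plus a function of the fibre splits [m]. If theta does
    not vanish, an element [v] of V that is trivial on fibres 0 and 2 is multiplied by its
    conjugate: the product takes equal values on fibres 0 and 1, where the fixed-point condition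
    applies, and this yields theta(t) [e v 1] = 0. Since normalizing [m] at [z] involves a choice,
    the isomorphism with Z/p is built on [commutator_value], which is additive in [m], unchanged by
    coboundaries, and congruent to theta(t) after normalization. Oddness of p enters through the 1/2
    in the quadratic cocycle and through p dividing C(p,2). *)

Lemma int_eq (a b : rat) : a \is a Num.int -> b = a -> b \is a Num.int.
Proof. by move=> ? ->. Qed.

Lemma int_opp (a : rat) : a \is a Num.int -> - a \is a Num.int.
Proof. by rewrite rpredN. Qed.

Definition modZ_const (X : Type) (u : X -> rat) := forall x y, u x - u y \is a Num.int.

(** * Multiples of a class of order p in Q/Z *)

Section Multiples.
Variables (p : nat) (pr : prime p).

(** The residue acts through its representative below p. The result is additive in [a] modulo Z once
    [p * t] is an integer, whence the hypothesis [pt] below. *)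
Definition fpmul (t : rat) (a : 'F_p) : rat := (a : nat)%:R * t.

Lemma natr_fp (a : 'F_p) : (a : nat)%:R = a :> 'F_p.
Proof. exact: natr_Zp. Qed.

Lemma fp_lt (a : 'F_p) : (a < p)%N.
Proof. by case: a => a /=; rewrite Fp_cast. Qed.

Lemma natr_fp_eq0 (n : nat) : ((n%:R : 'F_p) == 0) = (p %| n)%N.
Proof. by rewrite -(inj_eq val_inj) /= val_Fp_nat // /dvdn. Qed.

Variables (t : rat) (pt : p%:R * t \is a Num.int).

Lemma fpmul_nat n : n%:R * t - fpmul t n%:R \is a Num.int.
Proof.
rewrite /fpmul val_Fp_nat // {1}(divn_eq n p) natrD natrM.
by apply: (int_eq (rpredM (natr_int _ (n %/ p)) pt)); ring.
Qed.

Lemma fpmulD a b : fpmul t (a + b) - fpmul t a - fpmul t b \is a Num.int.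
Proof.
have := fpmul_nat (a + b)%N; rewrite [in fpmul _ _]natrD !natr_fp natrD => h.
by apply: (int_eq (int_opp h)); rewrite /fpmul; ring.
Qed.

Lemma fpmul0 : fpmul t 0 = 0.
Proof. by rewrite /fpmul mul0r. Qed.

Lemma fpmulB a b : fpmul t (a - b) - fpmul t a + fpmul t b \is a Num.int.
Proof. by have := fpmulD (a - b) b; rewrite subrK => h; apply: (int_eq (int_opp h)); ring. Qed.

Lemma fpmul1 : fpmul t 1 = t.
Proof. by rewrite /fpmul (_ : (1 : 'F_p) = 1%:R) // val_Fp_nat // modn_small ?mul1r ?prime_gt1. Qed.

Lemma fpmul_eq0 a : a != 0 -> fpmul t a \is a Num.int -> t \is a Num.int.
Proof.
move=> nza ha.
have ia : (a : nat)%:R * t \is a Num.int by [].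
have h := fpmul_nat ((a : nat) * (a^-1 : 'F_p))%N.
rewrite [in fpmul _ _]natrM !natr_fp divff // in h.
rewrite fpmul1 natrM in h.
have h2 := rpredM (natr_int rat (a^-1 : 'F_p)) ia.
by apply: (int_eq (rpredB h2 h)); ring.
Qed.

End Multiples.

(** * Solving a difference equation along the orbits of a map of prime order *)

Section Orbits.
Variables (X : finType) (f : X -> X) (p : nat).
Hypotheses (pr : prime p) (fp : forall x, iter p f x = x).

Lemma iter_prime_inj : injective f.
Proof. by move=> x y /(congr1 (iter p.-1 f)); rewrite -!iterSr prednK ?prime_gt0 // !fp. Qed.

Lemma order_iter_prime x : f x != x -> fingraph.order f x = p.
Proof.
move=> nfx; set o := fingraph.order f x.
have o0 : (0 < o)%N by apply: fingraph.order_gt0.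
have io2 k : iter (k * o) f x = x.
  by elim: k => //= k IH; rewrite mulSn iterD IH iter_order //; apply: iter_prime_inj.
have h : iter (p %% o)%N f x = x.
  by have := fp x; rewrite {1}(divn_eq p o) addnC iterD io2.
have h0 : (p %% o = 0)%N.
  by rewrite -(findex_iter (ltn_pmod p o0)) h findex0.
have /orP[/eqP o1|/eqP //] : (o == 1%N) || (o == p).
  by move/primeP: pr => [_]; apply; rewrite /dvdn h0.
have := iter_order iter_prime_inj x; rewrite -/o o1 /= => e.
by rewrite e eqxx in nfx.
Qed.

Variables (u : X -> rat) (s : rat).
Hypothesis usum : forall x, \sum_(k < p) u (iter k f x) - s \is a Num.int.
Hypothesis ufix : forall x, f x = x -> u x - s / p%:R \is a Num.int.

(** On an orbit of length p, [phi] is the partial sum of [u - s / p] from the root; closing the loop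
    costs the orbit sum minus [s], an integer by [usum]. At a fixed point [usum] only controls p
    times the error, and division by p is illegal modulo Z: hence [ufix]. *)
Lemma orbit_coboundary : exists phi, forall x,
  u x - s / p%:R - (phi (f x) - phi x) \is a Num.int.
Proof.
pose r x := froot f x; have injf := iter_prime_inj.
have csym := fconnect_sym injf.
have cr x : fconnect f (r x) x by rewrite csym; apply: connect_root.
pose n x := findex f (r x) x.
have rf x : r (f x) = r x by apply/eqP; rewrite /r root_connect // csym fconnect1.
exists (fun x => \sum_(k < n x) (u (iter k f (r x)) - s / p%:R)) => x.
have [fx|nfx] := eqVneq (f x) x; first by rewrite fx subrr subr0; apply: ufix.
have or : fingraph.order f (r x) = p.
  apply: order_iter_prime; apply: contra nfx => /eqP fr.
  have it k : iter k f (r x) = r x by elim: k => //= k ->.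
  by rewrite -(iter_findex (cr x)) it fr.
have nx : (n x < p)%N by rewrite -or; apply: findex_max.
have xE : iter (n x) f (r x) = x by apply: iter_findex.
have fxE : f x = iter (n x).+1 f (r x) by rewrite iterS xE.
have [lt|ge] := ltnP (n x).+1 p.
  have -> : n (f x) = (n x).+1 by rewrite /n rf fxE findex_iter // or.
  by rewrite rf big_ord_recr /= xE; apply: (int_eq (rpred0 _)); ring.
have nE : p = (n x).+1 by apply/eqP; rewrite eqn_leq ge nx.
have fxr : f x = r x by rewrite fxE -nE fp.
have -> : n (f x) = 0%N by rewrite /n rf fxr findex0.
rewrite big_ord0; have := usum (r x).
rewrite sumrB sumr_const card_ord nE big_ord_recr /= xE => h.
apply: (int_eq h); rewrite -mulr_natr.
have nz : (n x).+1%:R != 0 :> rat by rewrite pnatr_eq0.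
have := nz; rewrite -[(n x).+1]addn1 natrD => nz'.
by field.
Qed.

End Orbits.

(** * One-cocycles with values in functions modulo Z and constants *)

Section Cocycles.
Variables (X : finType).
Implicit Types (D G : {group {perm X}}) (m : {perm X} -> X -> rat) (phi : X -> rat).

(* Values in J (x) Q/Z, that is functions X -> Q/Z modulo constants, represented by
   rational-valued functions. *)
Definition cocycle1 D m := forall g h, g \in D -> h \in D ->
  modZ_const (fun x => m (g * h)%g x - m g x - m h (g x)).
Definition coboundary1 D m := exists phi, forall g, g \in D ->
  modZ_const (fun x => m g x - (phi (g x) - phi x)).
Definition twist m phi : {perm X} -> X -> rat := fun g x => m g x - (phi (g x) - phi x).

Lemma coboundary1S D G m : D \subset G -> coboundary1 G m -> coboundary1 D m.
Proof. by move=> /subsetP s [phi c]; exists phi => g /s; apply: c. Qed.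

Lemma cocycle1_twist D m phi : cocycle1 D m -> cocycle1 D (twist m phi).
Proof.
move=> c g h gD hD x y; apply: (int_eq (c g h gD hD x y)).
by rewrite /twist !permM; ring.
Qed.

Lemma coboundary1_twist D m phi : coboundary1 D m <-> coboundary1 D (twist m phi).
Proof.
split=> -[psi h].
  exists (fun x => psi x - phi x) => g gD x y.
  by apply: (int_eq (h g gD x y)); rewrite /twist; ring.
exists (fun x => psi x + phi x) => g gD x y.
by apply: (int_eq (h g gD x y)); rewrite /twist; ring.
Qed.

Lemma cocycle1_1 D m : cocycle1 D m -> modZ_const (m 1%g).
Proof.
move=> c x y; have := c _ _ (group1 D) (group1 D) x y.
by rewrite mulg1 !perm1 => h; apply: (int_eq (int_opp h)); ring.
Qed.

Lemma iter_perm (g : {perm X}) n x : iter n g x = (g ^+ n)%g x.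
Proof. by rewrite permX. Qed.

Lemma cocycle1X D m g n : cocycle1 D m -> g \in D ->
  modZ_const (fun x => m (g ^+ n)%g x - \sum_(k < n) m g (iter k g x)).
Proof.
move=> c gD; elim: n => [|n IH] x y.
  by rewrite expg0 !big_ord0 !subr0; apply: cocycle1_1 c _ _.
have h1 := c _ _ (groupX n gD) gD x y; have h2 := IH x y.
rewrite expgSr !big_ord_recr /=; rewrite !iter_perm.
by apply: (int_eq (rpredD h1 h2)); ring.
Qed.

(** The elements on which the cocycle [twist m phi] vanishes are closed under products, and in a
    finite group products of generators exhaust the generated subgroup. *)
Lemma coboundary1_gen D G m (S : {set {perm X}}) phi : cocycle1 G m -> S \subset G ->
  D \subset <<S>>%g -> (forall g, g \in S -> modZ_const (twist m phi g)) ->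
  forall g, g \in D -> modZ_const (twist m phi g).
Proof.
move=> c SG DS hS g /(subsetP DS).
have c' := cocycle1_twist phi c.
move=> /gen_prodgP[n [F FS ->]].
suff: (\prod_(i < n) F i)%g \in G /\ modZ_const (twist m phi (\prod_(i < n) F i)%g) by case.
elim: n F FS => [|n IH] F FS.
  by rewrite big_ord0; split; [exact: group1|exact: cocycle1_1 c'].
have /IH[i1 i2] : forall i, F (widen_ord (leqnSn n) i) \in S by move=> i; apply: FS.
rewrite big_ord_recr /=.
have FG : F ord_max \in G by apply: (subsetP SG); apply: FS.
split; first exact: groupM.
move=> x y; set P := (\prod_(i < n) _)%g in i1 i2 *.
have h := c' _ _ i1 FG x y.
apply: (int_eq (rpredD h (rpredD (i2 x y) (hS _ (FS ord_max) (P x) (P y))))).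
by ring.
Qed.

(* On a subgroup of prime order the class vanishes as soon as the function is
   constant modulo Z on the fixed points: the sums along the free orbits agree
   automatically because g ^+ p = 1, and Q/Z is divisible. *)
Lemma coboundary1_prime_cycle G m g p : prime p -> cocycle1 G m -> g \in G ->
  (g ^+ p = 1)%g ->
  (forall x y, g x = x -> g y = y -> m g x - m g y \is a Num.int) ->
  coboundary1 <[g]> m.
Proof.
move=> pr c gG gp fx.
have itp x : iter p g x = x by rewrite iter_perm gp perm1.
case: (pickP (fun x : X => true)) => [x0 _|X0]; last first.
  by exists (fun=> 0) => h _ x; have := X0 x.
(* [y0] is a fixed point of [g] whenever there is one, so that [s / p] is then the common value
   modulo Z of [m g] on fixed points. *)
pose y0 := odflt x0 [pick y | g y == y].
pose s := \sum_(k < p) m g (iter k g y0).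
have [phi phiE] : exists phi, forall x, m g x - s / p%:R - (phi (g x) - phi x) \is a Num.int.
  apply: orbit_coboundary => // x.
    have h := cocycle1X p c gG x y0; rewrite gp in h.
    by apply: (int_eq (rpredB (cocycle1_1 c x y0) h)); rewrite /s; ring.
  move=> gx; have gy0 : g y0 = y0.
    by rewrite /y0; case: pickP => [y /eqP //|/(_ x)]; rewrite gx eqxx.
  have -> : s = p%:R * m g y0.
    rewrite /s (eq_bigr (fun=> m g y0)) ?sumr_const ?card_ord ?mulr_natl //.
    by move=> k _; congr (m g _); elim: (nat_of_ord k) => //= j ->.
  have p0 : p%:R != 0 :> rat by rewrite pnatr_eq0 -lt0n prime_gt0.
  by apply: (int_eq (fx _ _ gx gy0)); field.
exists phi; apply: (@coboundary1_gen <[g]> G m [set g]) => //.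
  by rewrite sub1set.
move=> h /set1P -> x y; apply: (int_eq (rpredB (phiE x) (phiE y))).
by rewrite /twist; ring.
Qed.

(* Averaging over D: the rational analogue of H^1(D, -) = 0. *)
Lemma average1 D (b : {perm X} -> X -> rat) :
  (forall g h, g \in D -> h \in D -> forall x y,
     b (g * h)%g x - b g x - b h (g x) = b (g * h)%g y - b g y - b h (g y)) ->
  exists phi, forall g, g \in D -> forall x y,
     twist b phi g x = twist b phi g y.
Proof.
move=> bD; exists (fun x => - (#|D|%:R^-1 * \sum_(h in D) b h x)) => g gD x y.
have N0 : #|D|%:R != 0 :> rat by rewrite pnatr_eq0 -lt0n cardG_gt0.
have reindex z : \sum_(h in D) b (g * h)%g z = \sum_(h in D) b h z.
  rewrite [RHS](reindex_inj (mulgI g)) /=; apply: eq_bigl => h.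
  by rewrite groupMl.
have E z : \sum_(h in D) (b (g * h)%g z - b g z - b h (g z)) =
  \sum_(h in D) b h z - #|D|%:R * b g z - \sum_(h in D) b h (g z).
  by rewrite !sumrB reindex sumr_const mulr_natl.
have : \sum_(h in D) (b (g * h)%g x - b g x - b h (g x)) =
       \sum_(h in D) (b (g * h)%g y - b g y - b h (g y)).
  by apply: eq_bigr => h hD; apply: bD.
rewrite !E /twist => Eq.
apply: (mulfI N0); rewrite !mulrBr !mulrN !mulVKf //.
have swap (A B C : rat) : A - (- C - - B) = - (B - A - C) by ring.
by rewrite !swap Eq.
Qed.

End Cocycles.

(* In the paper's notation on Z/p x Z/p: z is rho_1, and g sends (a, b) to
   (a + c g, b + e g a); F is the inverse of (i, j). *)
Record coordinates (p : nat) (X : finType) (G : {group {perm X}}) (z t : {perm X})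
    (i j : X -> 'F_p) (c : {perm X} -> 'F_p) (e : {perm X} -> 'F_p -> 'F_p)
    (F : 'F_p -> 'F_p -> X) : Prop := Coordinates {
  coord_z : z \in G;
  coord_t : t \in G;
  coord_iF : forall a b, i (F a b) = a;
  coord_jF : forall a b, j (F a b) = b;
  coord_F : forall x, F (i x) (j x) = x;
  coord_i : forall g x, g \in G -> i (g x) = i x + c g;
  coord_j : forall g x, g \in G -> j (g x) = j x + e g (i x);
  coord_cz : c z = 0;
  coord_ez : forall a, e z a = 1;
  coord_ct : c t = 1 }.

(** * Computing in coordinates *)

Section Coord.
Variables (p : nat) (pr : prime p) (X : finType) (G : {group {perm X}}).
Variables (z t : {perm X}) (i j : X -> 'F_p) (c : {perm X} -> 'F_p).
Variables (e : {perm X} -> 'F_p -> 'F_p) (F : 'F_p -> 'F_p -> X).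
Hypothesis cd : coordinates G z t i j c e F.
Let zG := coord_z cd.
Let tG := coord_t cd.
Let iF := coord_iF cd.
Let jF := coord_jF cd.
Let iE := coord_i cd.
Let jE := coord_j cd.

Lemma coord_inj x y : i x = i y -> j x = j y -> x = y.
Proof. by move=> hi hj; rewrite -(coord_F cd x) -(coord_F cd y) hi hj. Qed.

Lemma coord_cM g h : g \in G -> h \in G -> c (g * h)%g = c g + c h.
Proof.
move=> gG hG; have := iE (F 0 0) (groupM gG hG).
by rewrite permM !iE // !iF !add0r => <-.
Qed.

Lemma coord_eM g h a : g \in G -> h \in G -> e (g * h)%g a = e g a + e h (a + c g).
Proof.
move=> gG hG; have := jE (F a 0) (groupM gG hG).
by rewrite permM !jE ?iE // !iF !jF !add0r => <-.
Qed.

Lemma coord_c1 : c 1%g = 0.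
Proof. by have := iE (F 0 0) (group1 G); rewrite perm1 iF add0r => <-. Qed.

Lemma coord_e1 a : e 1%g a = 0.
Proof. by have := jE (F a 0) (group1 G); rewrite perm1 iF jF add0r => <-. Qed.

Lemma coord_cX g n : g \in G -> c (g ^+ n)%g = c g *+ n.
Proof.
move=> gG; elim: n => [|n IH]; first by rewrite expg0 coord_c1.
by rewrite expgSr coord_cM ?groupX // IH mulrSr.
Qed.

Lemma coord_cV g : g \in G -> c g^-1%g = - c g.
Proof.
move=> gG; apply/eqP; rewrite -addr_eq0 -coord_cM ?groupV //.
by rewrite mulVg coord_c1.
Qed.

Lemma coord_eX g n a : g \in G -> c g = 0 -> e (g ^+ n)%g a = e g a *+ n.
Proof.
move=> gG cg; elim: n => [|n IH]; first by rewrite expg0 coord_e1.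
by rewrite expgSr coord_eM ?groupX // IH coord_cX // cg mul0rn addr0 mulrSr.
Qed.

Lemma coord_perm_inj g h : g \in G -> h \in G -> c g = c h ->
  (forall a, e g a = e h a) -> g = h.
Proof.
move=> gG hG ch eh; apply/permP => x; apply: coord_inj.
  by rewrite !iE // ch.
by rewrite !jE // eh.
Qed.

Lemma coord_fix g x : g \in G -> c g = 0 -> e g (i x) = 0 -> g x = x.
Proof. by move=> gG cg eg; apply: coord_inj; rewrite ?iE ?jE // ?cg ?eg addr0. Qed.

Lemma coord_czX n : c (z ^+ n)%g = 0.
Proof. by rewrite coord_cX // (coord_cz cd) mul0rn. Qed.

Lemma coord_ezX n a : e (z ^+ n)%g a = n%:R.
Proof. by rewrite coord_eX ?(coord_cz cd) // (coord_ez cd). Qed.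

Lemma z_central g : g \in G -> (g * z)%g = (z * g)%g.
Proof.
move=> gG; apply: coord_perm_inj; rewrite ?groupM //.
  by rewrite !coord_cM // addrC.
by move=> a; rewrite !coord_eM // !(coord_ez cd) (coord_cz cd) addr0 addrC.
Qed.

Lemma fp_natr0 : p%:R = 0 :> 'F_p.
Proof. by apply/eqP; rewrite natr_fp_eq0. Qed.

Lemma zXp : (z ^+ p = 1)%g.
Proof.
apply: coord_perm_inj; rewrite ?groupX ?group1 ?coord_czX ?coord_c1 //.
by move=> a; rewrite coord_ezX coord_e1 fp_natr0.
Qed.

Lemma z_freeP x : z x <> x.
Proof.
move=> zx; have := jE x zG; rewrite zx (coord_ez cd) => /eqP.
by rewrite -subr_eq0 opprD addNKr oppr_eq0 oner_eq0.
Qed.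

Lemma zX_eq x y : i y = i x -> y = (z ^+ (j y - j x)%R)%g x.
Proof.
move=> hi; apply: coord_inj; rewrite ?iE ?jE ?groupX // ?coord_czX ?addr0 //.
by rewrite coord_ezX natr_fp addrC subrK.
Qed.

(** Since [t] moves each fibre to the next, the conjugate of [v] by [t] acts on a fibre as [v] acts
    on the following one. *)
Lemma conj_t v : v \in G -> c v = 0 ->
  exists2 w, [/\ w \in G, c w = 0 & forall a, e w a = e v (a + 1)]
  & (t * v = w * t)%g.
Proof.
move=> vG cv; have [w wG h] : exists2 w, w \in G & (t * v = w * t)%g.
  by exists (v ^ t^-1)%g; rewrite ?groupJ ?groupV // conjgE invgK !mulgA mulgKV.
have cw : c w = 0.
  by have := congr1 c h; rewrite !coord_cM // cv addr0 => /esym/eqP; rewrite -subr_eq0 addrK =>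
      /eqP.
exists w => //; split=> // a; have := congr1 (fun g => e g a) h.
rewrite /= !coord_eM // (coord_ct cd) cw addr0 [RHS]addrC.
by move/addrI.
Qed.

(** * The homomorphism theta of a normalized cocycle *)

Section Norm.
Variable m : {perm X} -> X -> rat.
Hypothesis mc : cocycle1 G m.
Hypothesis mz : modZ_const (m z).
Hypothesis mfix : forall g x y, g \in G -> g x = x -> g y = y -> m g x - m g y \is a Num.int.

Let x0 := F 0 0.
Definition slope g : rat := m g (z x0) - m g x0.

(** Expand [m] at [g * z = z * g] in both ways: as [m z] is constant, the increment of [m g] along
    [z] is the same at every point modulo Z. *)
Lemma slopeP g x : g \in G -> m g (z x) - m g x - slope g \is a Num.int.
Proof.
move=> gG; have h1 := mc gG zG x x0; have h2 := mc zG gG x x0.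
rewrite z_central // in h1.
apply: (int_eq (rpredB (rpredB h1 h2) (rpredB (mz x x0) (mz (g x) (g x0))))).
by rewrite /slope; ring.
Qed.

Lemma slope_iter g x n : g \in G ->
  m g ((z ^+ n)%g x) - m g x - n%:R * slope g \is a Num.int.
Proof.
move=> gG; elim: n => [|n IH].
  by rewrite expg0 perm1 mul0r subr0 subrr rpred0.
rewrite expgSr permM.
apply: (int_eq (rpredD IH (slopeP ((z ^+ n)%g x) gG))).
by rewrite -[n.+1]addn1 natrD; ring.
Qed.

Lemma slope_p g : g \in G -> p%:R * slope g \is a Num.int.
Proof.
move=> gG; have := slope_iter x0 p gG; rewrite zXp perm1 => h.
by apply: (int_eq (int_opp h)); ring.
Qed.

Lemma slope_fib g x y : g \in G -> i y = i x ->
  m g y - m g x - fpmul (slope g) (j y - j x) \is a Num.int.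
Proof. by move=> gG hi; rewrite {1}(zX_eq hi); apply: slope_iter. Qed.

Lemma slopeM g h : g \in G -> h \in G ->
  slope (g * h)%g - slope g - slope h \is a Num.int.
Proof.
move=> gG hG; have h1 := mc gG hG (z x0) x0.
have := slopeP (g x0) hG.
have -> : z (g x0) = g (z x0) by rewrite -!permM z_central.
move=> h2; apply: (int_eq (rpredD h1 h2)); rewrite /slope; ring.
Qed.

Lemma slope1 : slope 1%g \is a Num.int.
Proof. exact: cocycle1_1 mc _ _. Qed.

Lemma slopeX g n : g \in G -> slope (g ^+ n)%g - n%:R * slope g \is a Num.int.
Proof.
move=> gG; elim: n => [|n IH].
  by rewrite expg0 mul0r subr0 slope1.
rewrite expgSr; apply: (int_eq (rpredD IH (slopeM (groupX n gG) gG))).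
by rewrite -[n.+1]addn1 natrD; ring.
Qed.

Lemma slope_z n : slope (z ^+ n)%g \is a Num.int.
Proof. by apply: (int_eq (rpredD (slopeX n zG) (rpredM (natr_int _ n) (mz (z x0) x0)))); rewrite
    /slope; ring. Qed.

(** A suitable power of [z] corrects [g] so that it fixes the fibre over 0 pointwise; there [mfix]
    compares [x0] with [z x0], and theta vanishes on powers of [z]. *)
Lemma slope_c0 g : g \in G -> c g = 0 -> slope g \is a Num.int.
Proof.
move=> gG cg; pose n : nat := (- e g 0)%R.
have zn : (z ^+ n)%g \in G by rewrite groupX.
have eh : e (g * z ^+ n)%g 0 = 0 by rewrite coord_eM // coord_ezX natr_fp subrr.
have ch : c (g * z ^+ n)%g = 0 by rewrite coord_cM // coord_czX cg addr0.
have sh : slope (g * z ^+ n)%g \is a Num.int.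
  apply: mfix; rewrite ?groupM // coord_fix ?groupM // ?iE // ?iF //.
  by rewrite (coord_cz cd) addr0.
by apply: (int_eq (rpredB sh (rpredD (slopeM gG zn) (slope_z n)))); ring.
Qed.

Lemma slope_c g : g \in G -> slope g - fpmul (slope t) (c g) \is a Num.int.
Proof.
move=> gG; pose n : nat := c g.
have tn : (t ^+ n)%g \in G by rewrite groupX.
have vG : (g * (t ^+ n)^-1)%g \in G by rewrite groupM ?groupV.
have cv : c (g * (t ^+ n)^-1)%g = 0.
  by rewrite coord_cM ?groupV // coord_cV // coord_cX // (coord_ct cd) natr_fp subrr.
have := slopeM vG tn; rewrite mulgKV => h.
by apply: (int_eq (rpredD (rpredD h (slope_c0 vG cv)) (slopeX n tG))); rewrite /fpmul; ring.
Qed.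

Lemma conj_cocycle v w : v \in G -> w \in G -> (t * v = w * t)%g ->
  modZ_const (fun x => m t x + m v (t x) - m w x - m t (w x)).
Proof.
move=> vG wG h x y.
have h1 := mc tG vG x y; have h2 := mc wG tG x y; rewrite -h in h2.
by apply: (int_eq (rpredB h2 h1)); ring.
Qed.

Lemma m_zX n : modZ_const (m (z ^+ n)%g).
Proof.
elim: n => [|n IH]; first by rewrite expg0; apply: cocycle1_1 mc.
move=> x y; rewrite expgSr; have h := mc (groupX n zG) zG x y.
by apply: (int_eq (rpredD (rpredD h (IH x y)) (mz ((z ^+ n)%g x) ((z ^+ n)%g y)))); ring.
Qed.

Lemma m_fib_c0 v x y : v \in G -> c v = 0 -> i y = i x -> m v y - m v x \is a Num.int.
Proof.
move=> vG cv hi; have s0 := slope_c0 vG cv.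
apply: (int_eq (rpredD (slope_fib vG hi) (rpredM (natr_int _ (j y - j x)%R) s0))).
by rewrite /fpmul; ring.
Qed.

(* If v takes equal values on two fibres then, after multiplication by a power of z,
   it fixes both of them pointwise. *)
Lemma m_eq_e v a b : v \in G -> c v = 0 -> e v a = e v b ->
  m v (F a 0) - m v (F b 0) \is a Num.int.
Proof.
move=> vG cv eab; pose n : nat := (- e v a)%R.
have zn : (z ^+ n)%g \in G by rewrite groupX.
have wG := groupM vG zn.
have fixw d : e v d = e v a -> (v * z ^+ n)%g (F d 0) = F d 0.
  move=> ed; apply: coord_fix; rewrite ?coord_cM ?coord_czX ?cv ?addr0 //.
  by rewrite iF coord_eM // coord_ezX natr_fp ed subrr.
have h1 := mfix wG (fixw a erefl) (fixw b (esym eab)).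
have h2 := mc vG zn (F a 0) (F b 0).
by apply: (int_eq (rpredB (rpredB h1 h2) (m_zX n (v (F a 0)) (v (F b 0))))); ring.
Qed.

Let D0 v := m v (F 1 0) - m v (F 0 0).
Let de v := e v 1 - e v 0.

Let D0M v w : v \in G -> w \in G -> c v = 0 -> c w = 0 -> D0 (v * w)%g - D0 v - D0 w \is a Num.int.
Proof.
move=> vG wG cv cw; have h := mc vG wG (F 1 0) (F 0 0).
have hf a : m w (v (F a 0)) - m w (F a 0) \is a Num.int.
  by apply: m_fib_c0 => //; rewrite iE // cv addr0.
by apply: (int_eq (rpredD h (rpredB (hf 1) (hf 0)))); rewrite /D0; ring.
Qed.

Let D0X v n : v \in G -> c v = 0 -> D0 (v ^+ n)%g - n%:R * D0 v \is a Num.int.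
Proof.
move=> vG cv; elim: n => [|n IH].
  by rewrite mul0r subr0 expg0; apply: (cocycle1_1 mc).
rewrite expgSr; have h := D0M (groupX n vG) vG _ cv.
have cn : c (v ^+ n)%g = 0 by rewrite coord_cX // cv mul0rn.
by apply: (int_eq (rpredD IH (h cn))); rewrite -[n.+1]addn1 natrD; ring.
Qed.

Let D0_eq0 v : v \in G -> c v = 0 -> de v = 0 -> D0 v \is a Num.int.
Proof. by move=> vG cv /eqP; rewrite subr_eq0 => /eqP h; apply: m_eq_e. Qed.

(** On V, both [D0] modulo Z and [de] are homomorphisms, and by [m_eq_e] the first vanishes where
    the second does. So [D0] factors through [de], and [r] is its value at an element with [de]
    equal to 1 (or 0 if [de] is zero). *)
Lemma D0_slope : exists2 r, p%:R * r \is a Num.int &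
  forall v, v \in G -> c v = 0 -> D0 v - fpmul r (de v) \is a Num.int.
Proof.
case: (pickP (fun v => [&& v \in G, c v == 0 & de v != 0])) => [v /and3P[vG /eqP cv dv]|none].
  pose k : nat := (de v)^-1%R; set v1 := (v ^+ k)%g.
  have v1G : v1 \in G by rewrite groupX.
  have cv1 : c v1 = 0 by rewrite coord_cX // cv mul0rn.
  have dv1 : de v1 = 1.
    by rewrite /de !coord_eX // -mulrnBl -mulr_natr natr_fp divff.
  have dX u n : u \in G -> c u = 0 -> de (u ^+ n)%g = de u *+ n.
    by move=> uG cu; rewrite /de !coord_eX // -mulrnBl.
  have pr0 : p%:R * D0 v1 \is a Num.int.
    have h : D0 (v1 ^+ p)%g \is a Num.int.
      by apply: D0_eq0; [rewrite groupX|rewrite coord_cX // cv1 mul0rn|rewrite dX // dv1 fp_natr0].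
    by apply: (int_eq (rpredB h (D0X p v1G cv1))); ring.
  exists (D0 v1) => // u uG cu.
  pose n : nat := de u; have wG : (u * (v1 ^+ n)^-1)%g \in G by rewrite groupM ?groupV ?groupX.
  have vnG : (v1 ^+ n)%g \in G by rewrite groupX.
  have cvn : c (v1 ^+ n)%g = 0 by rewrite coord_cX // cv1 mul0rn.
  have cw : c (u * (v1 ^+ n)^-1)%g = 0 by rewrite coord_cM ?groupV // coord_cV // cvn cu subrr.
  have dw : de (u * (v1 ^+ n)^-1)%g = 0.
    have : de u = de (u * (v1 ^+ n)^-1)%g + de (v1 ^+ n)%g.
      rewrite -{1}[u](mulgKV (v1 ^+ n)%g) /de !(coord_eM _ wG vnG) cw !addr0.
      by rewrite opprD addrACA.
    by rewrite dX // dv1 natr_fp => /eqP; rewrite -subr_eq addrN eq_sym => /eqP.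
  have := D0M wG vnG cw cvn; rewrite mulgKV => h.
  apply: (int_eq (rpredD (rpredD h (D0_eq0 wG cw dw)) (D0X n v1G cv1))).
  by rewrite /fpmul; ring.
exists 0; first by rewrite mulr0 rpred0.
move=> v vG cv; rewrite /fpmul mulr0 subr0; apply: D0_eq0 => //.
by apply/eqP; have := none v; rewrite vG cv eqxx /= => /negbFE.
Qed.

(** * Vanishing theta: the class is trivial *)

Section Kernel.
Hypothesis st : slope t \is a Num.int.

Lemma m_fib g x y : g \in G -> i y = i x -> m g y - m g x \is a Num.int.
Proof.
move=> gG hi.
have s0 : slope g \is a Num.int.
  by apply: (int_eq (rpredD (slope_c gG) (rpredM (natr_int _ (c g)) st))); rewrite /fpmul; ring.
apply: (int_eq (rpredD (slope_fib gG hi) (rpredM (natr_int _ (j y - j x)%R) s0))).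
by rewrite /fpmul; ring.
Qed.

(** Conjugation by [t] carries [D0_slope] from fibres 0, 1 to fibres k, k + 1 with the same [r],
    because the terms in [m t] cancel: [m t] is constant on fibres. Summing over k gives the
    claim. *)
Lemma m_V : exists2 r, p%:R * r \is a Num.int &
  forall v, v \in G -> c v = 0 -> modZ_const (fun x => m v x - fpmul r (e v (i x))).
Proof.
have [r pr0 rE] := D0_slope; exists r => //.
have step (k : nat) v : v \in G -> c v = 0 ->
    m v (F (k%:R + 1) 0) - m v (F k%:R 0) - fpmul r (e v (k%:R + 1) - e v k%:R) \is a Num.int.
  elim: k v => [|k IH] v vG cv.
    by rewrite add0r; apply: rE.
  have [w [wG cw ew] tw] := conj_t vG cv.
  have h := conj_cocycle vG wG tw (F (k%:R + 1) 0) (F k%:R 0).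
  have ht a : m t (w (F a 0)) - m t (F a 0) \is a Num.int.
    by apply: m_fib => //; rewrite iE // cw addr0.
  have hv a : m v (t (F a 0)) - m v (F (a + 1) 0) \is a Num.int.
    by apply: m_fib => //; rewrite iE // (coord_ct cd) !iF.
  have := IH w wG cw; rewrite !ew -[k.+1]addn1 natrD => h2.
  apply: (int_eq (rpredD (rpredD h h2) (rpredD (rpredB (ht (k%:R + 1)) (ht k%:R))
     (rpredB (hv k%:R) (hv (k%:R + 1)))))).
  by ring.
move=> v vG cv.
have tot (k : nat) : m v (F k%:R 0) - fpmul r (e v k%:R) - (m v (F 0 0) - fpmul r (e v 0)) \is a
    Num.int.
  elim: k => [|k IH]; first by rewrite subrr rpred0.
  rewrite -[k.+1]addn1 natrD.
  apply: (int_eq (rpredD (rpredD IH (step k v vG cv)) (fpmulB pr pr0 (e v (k%:R + 1)) (e v k%:R)))).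
  by ring.
have tot' x : m v x - fpmul r (e v (i x)) - (m v (F 0 0) - fpmul r (e v 0)) \is a Num.int.
  have := tot (i x); rewrite natr_fp => h.
  have hf : m v x - m v (F (i x) 0) \is a Num.int by apply: m_fib_c0; rewrite // iF.
  by apply: (int_eq (rpredD h hf)); ring.
by move=> x y; apply: (int_eq (rpredB (tot' x) (tot' y))); ring.
Qed.

Lemma slope0_coboundary1 : coboundary1 G m.
Proof.
have [r pr0 mV] := m_V.
(* The term [r * j] settles V; [u] is what it leaves of [m t], a function of the fibre only. Since
   +1 is a single p-cycle on ['F_p], [u] is a difference [psi (k + 1) - psi k] up to the constant
   [s / p]. *)
pose u k := m t (F k 0) - fpmul r (e t k).
pose s := \sum_(k < p) u k%:R.
have inp k (a : 'F_p) : iter k (+%R^~ 1) a = a + k%:R.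
  elim: k => [|k /= ->]; first by rewrite addr0.
  by rewrite -addrA -natr1.
have [psi psiE] : exists psi, forall k, u k - s / p%:R - (psi (k + 1) - psi k) \is a Num.int.
  apply: (orbit_coboundary pr) => [a|a|a /eqP].
  - by rewrite inp fp_natr0 addr0.
  - rewrite (_ : \sum_(k < p) _ = s) ?subrr ?rpred0 //.
    rewrite /s (eq_bigr (fun k : 'I_p => u (a + k%:R))); last by move=> k _; rewrite inp.
    have E (f : 'F_p -> rat) : \sum_(k < p) f k%:R = \sum_(k : 'F_p) f k.
      rewrite [RHS](reindex (fun k : 'I_p => k%:R : 'F_p)) //.
      exists (fun k : 'F_p => Ordinal (fp_lt pr k)) => k _.
        by apply: val_inj; rewrite /= val_Fp_nat // modn_small.
      by rewrite natr_fp.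
    by rewrite (E (fun k => u (a + k))) E [RHS](reindex_inj (addrI a)).
  - by rewrite -subr_eq0 addrAC subrr add0r oner_eq0.
pose phi x := fpmul r (j x) + psi (i x).
exists phi.
have tV v : v \in G -> c v = 0 -> modZ_const (twist m phi v).
  move=> vG cv x y; rewrite /twist /phi !iE ?jE // cv !addr0.
  apply: (int_eq (rpredD (mV v vG cv x y) (rpredB (fpmulD pr pr0 (j y) (e v (i y)))
     (fpmulD pr pr0 (j x) (e v (i x)))))).
  by ring.
have tt : modZ_const (twist m phi t).
  have h x : twist m phi t x - s / p%:R \is a Num.int.
    rewrite /twist /phi iE ?jE // (coord_ct cd).
    have hf : m t x - m t (F (i x) 0) \is a Num.int by apply: m_fib; rewrite ?iF.
    apply: (int_eq (rpredB (rpredD hf (psiE (i x))) (fpmulD pr pr0 (j x) (e t (i x))))).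
    by rewrite /u; ring.
  by move=> x y; apply: (int_eq (rpredB (h x) (h y))); ring.
pose S := t |: [set v in G | c v == 0].
apply: (@coboundary1_gen _ G G m S) => //.
- by apply/subsetP => g; rewrite !inE => /orP[/eqP -> //|/andP[]].
- apply/subsetP => g gG; pose n : nat := c g.
  rewrite -[g](mulgKV (t ^+ n)%g) groupM ?groupX ?mem_gen // !inE ?eqxx //.
  by rewrite groupM ?groupV ?groupX //= coord_cM ?groupV ?groupX // coord_cV ?groupX // coord_cX
      // (coord_ct cd) natr_fp subrr eqxx orbT.
- by move=> g; rewrite !inE => /orP[/eqP -> //|/andP[gG /eqP cg]]; apply: tV.
Qed.

End Kernel.

(** * Nonvanishing theta: restrictions on the group *)

Section Nonzero.
Hypothesis st : slope t \isn't a Num.int.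

Let st0 (a : 'F_p) : fpmul (slope t) a \is a Num.int -> a = 0.
Proof.
move=> h; apply/eqP; apply: contraNT st => a0.
by apply: (fpmul_eq0 pr (slope_p tG) a0).
Qed.

(** Outside V, [g] permutes the fibres cyclically and commutes with its p-th power, so [e (g ^+ p)]
    is constant and the power is some [z ^+ k]. As [m] is constant there, k theta(g) = 0; but
    theta(g) = [c g] theta(t) is nonzero, so p divides k. *)
Lemma slope_expp g : g \in G -> (g ^+ p = 1)%g.
Proof.
move=> gG; have yG : (g ^+ p)%g \in G by rewrite groupX.
have cy : c (g ^+ p)%g = 0 by rewrite coord_cX // -mulr_natr fp_natr0 mulr0.
apply: coord_perm_inj; rewrite ?group1 ?coord_c1 // => a; rewrite coord_e1.
have [cg|cg] := eqVneq (c g) 0; first by rewrite coord_eX // -mulr_natr fp_natr0 mulr0.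
have ey1 b : e (g ^+ p)%g (b + c g) = e (g ^+ p)%g b.
  have := congr1 (fun h => e h b) (commuteX p (commute_refl g)).
  by rewrite /= !(coord_eM _ gG yG) (coord_eM _ yG gG) cy addr0 addrC => /addIr.
have ey b : e (g ^+ p)%g b = e (g ^+ p)%g 0.
  have h n : e (g ^+ p)%g (n%:R * c g) = e (g ^+ p)%g 0.
    elim: n => [|n IH]; first by rewrite mul0r.
    by rewrite -natr1 mulrDl mul1r ey1.
  by rewrite -(h (b / c g)%R) natr_fp divfK.
pose k : nat := e (g ^+ p)%g 0.
have yz : (g ^+ p = z ^+ k)%g.
  apply: coord_perm_inj; rewrite ?groupX // ?coord_czX // => b.
  by rewrite coord_ezX natr_fp ey.
have h1 := cocycle1X p mc gG (g x0) x0; rewrite yz in h1.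
have h2 := m_zX k (g x0) x0.
(* Shifting the start of the sum by one step of [g] changes only its end terms. *)
have h3 : \sum_(l < p) m g (iter l g (g x0)) - \sum_(l < p) m g (iter l g x0)
          = m g ((z ^+ k)%g x0) - m g x0.
  have -> : (z ^+ k)%g x0 = iter p g x0 by rewrite iter_perm yz.
  have /= <- := telescope_sumr (fun l => m g (iter l g x0)) (leq0n p).
  rewrite big_mkord -sumrB.
  by apply: eq_bigr => l _; rewrite -iterSr.
have h4 := slope_iter x0 k gG.
have h5 : fpmul (slope g) (e (g ^+ p)%g 0) \is a Num.int.
  apply: (int_eq (rpredB (rpredB h2 h1) h4)); rewrite /fpmul -/k.
  have -> : forall A B C D E : rat, A - B - (A - C - (B - D)) - E = C - D - E.
    by move=> A B C D E; ring.
  by rewrite h3; ring.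
rewrite ey; apply/eqP; apply: contraNT st => ne.
have sg := fpmul_eq0 pr (slope_p gG) ne h5.
by apply: (fpmul_eq0 pr (slope_p tG) cg); apply: (int_eq (rpredB sg (slope_c gG))); ring.
Qed.

(** With [w] the conjugate of [v], the function of [v * w] equals [e v 1] on fibres 0 and 1, so
    [D0 v + D0 w] is integral. The relation [t * v = w * t] identifies this sum with theta(t) times
    [e v 1]. *)
Lemma slope_e02 v : v \in G -> c v = 0 -> e v 0 = 0 -> e v (1 + 1) = 0 -> e v 1 = 0.
Proof.
move=> vG cv e0 e2; apply: st0.
have [w [wG cw ew] tw] := conj_t vG cv.
have h := conj_cocycle vG wG tw (F 1 0) (F 0 0).
have ht a : m t (w (F a 0)) - m t (F a 0) - fpmul (slope t) (e v (a + 1)) \is a Num.int.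
  have hi : i (w (F a 0)) = i (F a 0) by rewrite iE // cw addr0.
  by have := slope_fib tG hi; rewrite jE // iF jF add0r subr0 ew.
have hv a : m v (t (F a 0)) - m v (F (a + 1) 0) \is a Num.int.
  by apply: m_fib_c0 => //; rewrite iE // (coord_ct cd) !iF.
have h02 : m v (F (1 + 1) 0) - m v (F 0 0) \is a Num.int by apply: m_eq_e; rewrite // e2 e0.
have h01 : D0 (v * w)%g \is a Num.int.
  apply: m_eq_e; rewrite ?groupM // ?coord_cM ?cv ?cw ?addr0 //.
  by rewrite !coord_eM // cv !addr0 !ew e2 e0 !add0r addr0.
have h1 := ht 1; rewrite e2 fpmul0 in h1.
have h0 := ht 0; have hv0 := hv 0; rewrite add0r in h0 hv0.
have hM := D0M vG wG cv cw.
apply: (int_eq (rpredD (rpredB (rpredB h h02) (rpredB (hv 1) hv0))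
  (rpredD (rpredB h1 h0) (rpredB h01 hM)))).
by rewrite /D0; ring.
Qed.

(** Two consecutive zeros of [e u] force a third ([two]); translating by conjugation then spreads
    zeros to all fibres. *)
Lemma slope_e01 v : v \in G -> c v = 0 -> e v 0 = 0 -> e v 1 = 0 -> v = 1%g.
Proof.
have two u : u \in G -> c u = 0 -> e u 0 = 0 -> e u 1 = 0 -> e u (1 + 1) = 0.
  move=> uG cu u0 u1; apply/eqP; apply: contraT => u2.
  have [s [sG cs es] _] := conj_t uG cu.
  (* The exponent that makes [s * u ^+ n] vanish on fibre 2; it vanishes on fibre 0 and equals
     [e u (1 + 1)] on fibre 1, so [slope_e02] applies. *)
  pose n : nat := (- e u (1 + 1 + 1) / e u (1 + 1))%R.
  have unG : (u ^+ n)%g \in G by rewrite groupX.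
  have := @slope_e02 (s * u ^+ n)%g; rewrite !(coord_eM _ sG unG) !coord_eX // cs !addr0 !es add0r.
  rewrite u0 u1 !mul0rn !addr0 -mulr_natr natr_fp mulrCA divff // mulr1 subrr.
  move=> h; rewrite h ?eqxx // in u2; first exact: groupM.
  by rewrite (coord_cM sG unG) cs coord_cX // cu mul0rn addr0.
move=> vG cv v0 v1; apply: coord_perm_inj; rewrite ?group1 ?coord_c1 // => a; rewrite coord_e1.
suff h (k : nat) u : u \in G -> c u = 0 -> e u 0 = 0 -> e u 1 = 0 ->
    e u k%:R = 0 by rewrite -(natr_fp a) h.
elim: k u => [//|k IH] u uG cu u0 u1.
have [s [sG cs es] _] := conj_t uG cu.
by rewrite -natr1 -es; apply: IH; rewrite ?es ?add0r // two.
Qed.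

End Nonzero.
End Norm.

(** * An additive invariant independent of the normalization *)

(** The two expansions of [m] at [t * z = z * t] compared at the base point. When [m z] is constant
    the second difference is integral and [slope m t] remains. *)
Definition commutator_value (m : {perm X} -> X -> rat) : rat :=
  m t (z (F 0 0)) - m t (F 0 0) - (m z (t (F 0 0)) - m z (F 0 0)).

Definition agrees_on_fix (m : {perm X} -> X -> rat) :=
  forall g x y, g \in G -> g x = x -> g y = y -> m g x - m g y \is a Num.int.

Lemma agrees_twist m phi : agrees_on_fix m -> agrees_on_fix (twist m phi).
Proof.
by move=> h g x y gG gx gy; rewrite /twist gx gy !subrr !subr0; apply: h.
Qed.

Lemma normalize m : cocycle1 G m -> exists phi, modZ_const (twist m phi z).
Proof.
move=> mc; have [|phi h] := coboundary1_prime_cycle pr mc zG zXp.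
  by move=> x y /z_freeP.
by exists phi; apply: h; rewrite cycle_id.
Qed.

Lemma commutator_twist m phi : commutator_value (twist m phi) = commutator_value m.
Proof.
rewrite /commutator_value /twist.
have -> : z (t (F 0 0)) = t (z (F 0 0)) by rewrite -!permM z_central.
by ring.
Qed.

Lemma slope_commutator m phi : modZ_const (twist m phi z) ->
  slope (twist m phi) t - commutator_value m \is a Num.int.
Proof.
move=> h; rewrite -(commutator_twist m phi).
by apply: (int_eq (h (t (F 0 0)) (F 0 0))); rewrite /slope /commutator_value; ring.
Qed.

Lemma slope_commutator_int m phi : modZ_const (twist m phi z) ->
  (slope (twist m phi) t \is a Num.int) = (commutator_value m \is a Num.int).
Proof.
move=> h; have hs := slope_commutator h; apply/idP/idP => h'.
  by apply: (int_eq (rpredB h' hs)); ring.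
by apply: (int_eq (rpredD h' hs)); ring.
Qed.

Lemma commutator_p m : cocycle1 G m -> p%:R * commutator_value m \is a Num.int.
Proof.
move=> mc; have [phi h] := normalize mc.
have h1 := slope_p (cocycle1_twist phi mc) h tG.
have h2 := rpredM (natr_int rat p) (slope_commutator h).
by apply: (int_eq (rpredB h1 h2)); ring.
Qed.

Lemma commutator_coboundary m : cocycle1 G m -> agrees_on_fix m ->
  commutator_value m \is a Num.int -> coboundary1 G m.
Proof.
move=> mc mf cm; have [phi h] := normalize mc.
apply/(coboundary1_twist _ _ phi).
apply: (slope0_coboundary1 (cocycle1_twist phi mc) h (agrees_twist phi mf)).
by rewrite slope_commutator_int.
Qed.

Lemma coboundary_commutator m : coboundary1 G m -> commutator_value m \is a Num.int.
Proof.
move=> [phi h].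
have hz : modZ_const (twist m phi z) by apply: h.
by rewrite -(slope_commutator_int hz); apply: h.
Qed.

Lemma commutator_expp m g : cocycle1 G m -> agrees_on_fix m ->
  commutator_value m \isn't a Num.int -> g \in G -> (g ^+ p = 1)%g.
Proof.
move=> mc mf cm; have [phi h] := normalize mc; apply: (@slope_expp (twist m phi)) => //.
- exact: cocycle1_twist.
- exact: agrees_twist.
- by rewrite slope_commutator_int.
Qed.

Lemma commutator_e01 m v : cocycle1 G m -> agrees_on_fix m ->
  commutator_value m \isn't a Num.int -> v \in G -> c v = 0 -> e v 0 = 0 -> e v 1 = 0 -> v = 1%g.
Proof.
move=> mc mf cm; have [phi h] := normalize mc; apply: (@slope_e01 (twist m phi)) => //.
- exact: cocycle1_twist.
- exact: agrees_twist.
- by rewrite slope_commutator_int.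
Qed.

Lemma commute_t_e v a : v \in G -> c v = 0 -> commute t v -> e v a = e v 0.
Proof.
move=> vG cv tv.
have step b : e v (b + 1) = e v b.
  have := congr1 (fun h => e h b) tv.
  by rewrite /= !coord_eM // cv (coord_ct cd) addr0 addrC => /addIr.
by rewrite -(natr_fp a); elim: (nat_of_ord a) => // k IH; rewrite -natr1 step.
Qed.

Lemma e_const_z v : v \in G -> c v = 0 -> (forall a, e v a = e v 0) -> v \in <[z]>%g.
Proof.
move=> vG cv ev; apply/cycleP; exists (e v 0).
by apply: coord_perm_inj; rewrite ?groupX ?coord_czX // => a; rewrite coord_ezX natr_fp.
Qed.

Definition fibre_kernel := [set v in G | c v == 0].

Lemma card_fibre_kernel : (#|fibre_kernel| * p = #|G|)%N.
Proof.
rewrite -[X in (_ * X)%N](card_Fp pr) -cardsT -cardsX.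
have inj : {in setX fibre_kernel [set: 'F_p] &, injective (fun vk : {perm X} * 'F_p => (vk.1 * t
    ^+ (vk.2 : nat))%g)}.
  move=> [v k] [w l]; rewrite !inE /= !andbT => /andP[vG /eqP cv] /andP[wG /eqP cw] h.
  have kl : k = l.
    have := congr1 c h; rewrite !coord_cM ?groupX // cv cw !coord_cX // (coord_ct cd) !natr_fp.
    by rewrite !add0r.
  by move: h; rewrite kl => /mulIg ->.
rewrite -(card_in_imset inj); apply: eq_card => g; apply/imsetP/idP.
  by case=> -[v k]; rewrite !inE /= !andbT => /andP[vG _] ->; rewrite groupM ?groupX.
move=> gG; exists ((g * (t ^+ (c g : nat))^-1)%g, c g); last by rewrite /= mulgKV.
by rewrite !inE /= groupM ?groupV ?groupX //= coord_cM ?groupV ?groupX // coord_cV ?groupX //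
    coord_cX // (coord_ct cd) natr_fp subrr eqxx.
Qed.

(* A class whose restriction to E is trivial has trivial commutator with z: either E
   meets the complement of the fibre kernel V, or E = V and conjugation by t acts
   nontrivially on V. *)
Lemma coboundary_abelem_commutator m (E : {group {perm X}}) : cocycle1 G m -> agrees_on_fix m ->
  E \subset G -> z \in E -> (#|E| = p ^ 2)%N -> (#|G| <= p ^ 3)%N ->
  coboundary1 E m -> commutator_value m \is a Num.int.
Proof.
move=> mc mf sE zE cE cG [phi h].
have hz : modZ_const (twist m phi z) by apply: h.
have mc' := cocycle1_twist phi mc; have mf' := agrees_twist phi mf.
rewrite -(slope_commutator_int hz).
case: (pickP (fun g => (g \in E) && (c g != 0))) => [g /andP[gE cg]|none].
  have gG := subsetP sE _ gE.
  have sg : slope (twist m phi) g \is a Num.int by apply: h.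
  apply: (fpmul_eq0 pr (slope_p mc' hz tG) cg).
  by apply: (int_eq (rpredB sg (slope_c mc' hz mf' gG))); ring.
(* Now [E] lies in V, whose order |G|/p is at most p^2. *)
have EV : E :=: fibre_kernel.
  apply/eqP; rewrite eqEcard; apply/andP; split.
    apply/subsetP => g gE; rewrite inE (subsetP sE) //=.
    by have := none g; rewrite gE /= => /negbFE.
  rewrite cE -(leq_pmul2r (prime_gt0 pr)) card_fibre_kernel.
  by rewrite (leq_trans cG) // expnSr.
have [v vE nv] : exists2 v, v \in E & v \notin <[z]>%g.
  apply/subsetPn; apply/negP => /subset_leq_card; rewrite cE leqNgt => /negP; apply.
  rewrite (@leq_ltn_trans p) //.
    by rewrite dvdn_leq ?prime_gt0 // -/(#[z])%g order_dvdn zXp.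
  by rewrite -[X in (X < _)%N]expn1 ltn_exp2l ?prime_gt1.
have [vG /eqP cv] : v \in G /\ c v == 0 by move: vE; rewrite EV inE => /andP[].
have [w [wG cw ew] tw] := conj_t vG cv.
have wE : w \in E by rewrite EV inE wG cw eqxx.
apply: contraR nv => st; apply: e_const_z => // a.
have h1 x := conj_cocycle mc' vG wG tw x (F (-1) 0).
pose mm := twist m phi.
(* The twisted cocycle vanishes at [v] and at its conjugate [w], both in [E], so the increment of
   [mm t] along [w] is constant; over fibre b - 1 it is theta(t) times [e v b]. *)
have key b : fpmul (slope mm t) (e v b) - fpmul (slope mm t) (e v 0) \is a Num.int.
  pose x := F (b - 1) 0; pose y := F (- 1) 0.
  have hs d : mm t (w (F (d - 1) 0)) - mm t (F (d - 1) 0) - fpmul (slope mm t) (e v d) \is a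
      Num.int.
    have hi : i (w (F (d - 1) 0)) = i (F (d - 1) 0) by rewrite iE // cw addr0.
    by have := slope_fib mc' hz tG hi; rewrite jE // iF jF add0r subr0 ew subrK.
  have := hs 0; rewrite sub0r => hs0.
  have hv := h v vE (t x) (t y); have hw := h w wE x y.
  apply: (int_eq (rpredB (rpredD (rpredB hv hw) (rpredB hs0 (hs b))) (h1 x))).
  by rewrite /mm /x /y /slope /twist; ring.
apply/eqP; rewrite -subr_eq0; apply: contraNT st => ne.
apply: (fpmul_eq0 pr (slope_p mc' hz tG) ne).
have := fpmulB pr (slope_p mc' hz tG) (e v a) (e v 0) => hB.
by apply: (int_eq (rpredD hB (key a))); rewrite /mm; ring.
Qed.

(** * The quadratic cocycle *)

Section Construction.
Hypothesis p2 : (2 < p)%N.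
Hypothesis et : forall a, e t a = 0.
Hypothesis comm_z : forall g, g \in G -> exists k, (t * g = g * t * z ^+ k)%g.
Variable s : rat.
Hypothesis ps : p%:R * s \is a Num.int.

Definition lin g := e g 1 - e g 0.

(** The commutator of [t] and [g] is a power of [z], so [e g] has constant increments. *)
Lemma e_affine g a : g \in G -> e g a = e g 0 + lin g * a.
Proof.
move=> gG; have [k tg] := comm_z gG.
have step b : e g (b + 1) = e g b + k%:R.
  have := congr1 (fun h => e h b) tg.
  by rewrite /= !coord_eM ?groupM ?groupX // !et coord_ezX (coord_ct cd) add0r addr0.
have lk : lin g = k%:R by rewrite /lin -[in e g 1](add0r 1) step addrC addKr.
rewrite -(natr_fp a) lk; elim: (nat_of_ord a) => [|n IH]; first by rewrite mulr0 addr0.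
by rewrite -natr1 step IH mulrDr mulr1 addrA.
Qed.

Lemma linM g h : g \in G -> h \in G -> lin (g * h)%g = lin g + lin h.
Proof.
move=> gG hG; rewrite {1}/lin !coord_eM // (e_affine (1 + c g)) // (e_affine (0 + c g)) //.
by rewrite (e_affine 1) //; ring.
Qed.

(* A lift to X -> F_p of a cocycle pairing c with j: the quadratic term in i
   corrects the failure of j to be invariant under the fibre kernel. *)
Definition quad g x : 'F_p :=
  c g * j x + lin g * (i x * (i x - 1) / 2%:R) + c g * lin g * i x.

Definition quad_cocycle g x := fpmul s (quad g x).

(** In the product [c * lin], the cross term [c h * lin g * i] absorbs the shift of [j] by the
    linear part of [e g], and [c g * lin h * i] the shift of i(i-1)/2 under translation by [c g]. *)
Lemma quadM g h x y : g \in G -> h \in G ->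
  quad (g * h)%g x - quad g x - quad h (g x) = quad (g * h)%g y - quad g y - quad h (g y).
Proof.
have two : 2%:R != 0 :> 'F_p.
  by rewrite natr_fp_eq0 //; apply/negP => /(dvdn_leq (isT : 0 < 2)%N); rewrite leqNgt p2.
move=> gG hG; rewrite /quad linM // coord_cM // !iE // !jE // (e_affine (i x)) // (e_affine (i
    y)) //.
by field.
Qed.

Lemma quad_cocycle1 : cocycle1 G quad_cocycle.
Proof.
move=> g h gG hG x y; rewrite /quad_cocycle.
have hx (a b d : 'F_p) : fpmul s a - fpmul s b - fpmul s d - fpmul s (a - b - d) \is a Num.int.
  by apply: (int_eq (int_opp (rpredD (fpmulB pr ps (a - b) d) (fpmulB pr ps a b)))); ring.
have h1 := hx (quad (g * h)%g x) (quad g x) (quad h (g x)).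
have h2 := hx (quad (g * h)%g y) (quad g y) (quad h (g y)).
rewrite (quadM x y) // in h1.
by apply: (int_eq (rpredB h1 h2)); ring.
Qed.

(** Fixed points force [c g = 0] and [e g] to vanish on their fibres. Being affine, [e g] has
    [lin g = 0] unless the two fibres coincide; either way the surviving quadratic term agrees. *)
Lemma quad_agrees : agrees_on_fix quad_cocycle.
Proof.
move=> g x y gG gx gy.
have cg : c g = 0 by have := iE x gG; rewrite gx => /eqP; rewrite -subr_eq0 opprD addNKr oppr_eq0
    => /eqP.
have e0 u : g u = u -> e g (i u) = 0.
  by move=> gu; have := jE u gG; rewrite gu => /eqP; rewrite -subr_eq0 opprD addNKr oppr_eq0 =>
      /eqP.
have : lin g * (i x - i y) = 0.
  have := e0 x gx; have := e0 y gy; rewrite !(e_affine (i _)) // => h1 h2.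
  by rewrite mulrBr; apply/eqP; rewrite subr_eq0; apply/eqP/(addrI (e g 0)); rewrite h1 h2.
rewrite /quad_cocycle /quad cg !mul0r !add0r !addr0 => /eqP.
rewrite mulf_eq0 (subr_eq0 (i x)) => /orP[/eqP ->|/eqP ->]; last by rewrite subrr rpred0.
by rewrite !mul0r subrr rpred0.
Qed.

Lemma quad_commutator : commutator_value quad_cocycle = s.
Proof.
rewrite /commutator_value /quad_cocycle /quad.
have lt : lin t = 0 by rewrite /lin !et subrr.
have lz : lin z = 0 by rewrite /lin !(coord_ez cd) subrr.
rewrite lt lz (coord_ct cd) (coord_cz cd) !mul0r !mulr0 !mul0r !addr0 !fpmul0 !mul1r.
by rewrite jE // jF (coord_ez cd) add0r fpmul0 fpmul1 // !subr0.
Qed.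

End Construction.
End Coord.

(** * From integral 2-cocycles on cosets to rational 1-cocycles on points *)

Section Translation.
Variables (X : finType) (G H : {group {perm X}}) (x0 : X).
Hypothesis trans : [transitive G, on [set: X] | 'P].
Hypothesis HE : H :=: ('C_G[x0 | 'P])%g.

Definition coset_of_point x : {set {perm X}} := [set g in G | g x0 == x].

Lemma transitive_perm_ex x : exists2 g, g \in G & g x0 = x.
Proof.
have /imsetP[y _ yE] := trans.
have x0y : x0 \in orbit 'P G y by rewrite -yE inE.
have : x \in orbit 'P G x0 by rewrite (orbit_in_eqP _ x0y) ?subsetT // -yE inE.
by case/imsetP => g gG ->; exists g.
Qed.

Lemma mem_stab g : (g \in H) = (g \in G) && (g x0 == x0).
Proof. by rewrite HE in_setI; congr (_ && _); apply/astab1P/eqP. Qed.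

Lemma coset_of_pointE g : g \in G -> coset_of_point (g x0) = (H :* g)%g.
Proof.
move=> gG; apply/setP => h; rewrite mem_rcoset mem_stab inE.
rewrite groupMr ?groupV //; congr (_ && _).
by rewrite permM (can2_eq (permKV g) (permK g)).
Qed.

Lemma mem_coset_of_point x : coset_of_point x \in rcosets H G.
Proof. by have [g gG <-] := transitive_perm_ex x; rewrite coset_of_pointE // mem_rcosets mulSGid
    // HE subsetIl. Qed.

Lemma rcosetsE C : C \in rcosets H G -> exists x, C = coset_of_point x.
Proof. by case/rcosetsP => g gG ->; exists (g x0); rewrite coset_of_pointE. Qed.

Lemma coset_of_pointM g x : g \in G -> (coset_of_point x :* g)%g = coset_of_point (g x).
Proof.
move=> gG; have [h hG <-] := transitive_perm_ex x.
by rewrite -permM !coset_of_pointE ?groupM // rcosetM.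
Qed.

Definition point_of_coset (C : {set {perm X}}) : X := repr C x0.

Lemma coset_of_pointK x : point_of_coset (coset_of_point x) = x.
Proof.
have [g gG gx] := transitive_perm_ex x; rewrite /point_of_coset.
have : repr (coset_of_point x) \in coset_of_point x.
  by apply: (mem_repr g); rewrite inE gG gx eqxx.
by rewrite inE => /andP[_ /eqP].
Qed.

Lemma JeqP m1 m2 : Jeq G H m1 m2 <-> forall x y,
  m1 (coset_of_point x) - m2 (coset_of_point x) = m1 (coset_of_point y) - m2 (coset_of_point y).
Proof.
split=> [[c cE] x y|h]; first by rewrite !cE ?mem_coset_of_point.
exists (m1 (coset_of_point x0) - m2 (coset_of_point x0)) => C /rcosetsE[x ->].
exact: h.
Qed.

Local Notation R f x := ((f (coset_of_point x))%:~R : rat).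

Lemma JeqPr m1 m2 : Jeq G H m1 m2 <-> forall x y,
  R m1 x - R m2 x = R m1 y - R m2 y.
Proof.
rewrite JeqP; split=> h x y; first by rewrite -!rmorphB (h x y).
by apply: (@intr_inj rat); rewrite !rmorphB /=; apply: h.
Qed.

(* The averaged cochain whose coboundary is f, modulo constants. *)
Definition cochain_of (f : cochain2 {perm X}) : {perm X} -> X -> rat :=
  fun g x => #|G|%:R^-1 * \sum_(k in G) R (f g k) x.

Lemma cochain_ofD f1 f2 g x :
  cochain_of (cochain2_add f1 f2) g x = cochain_of f1 g x + cochain_of f2 g x.
Proof.
rewrite /cochain_of -mulrDr -big_split /=; congr (_ * _).
by apply: eq_bigr => k _; rewrite -rmorphD.
Qed.

Lemma cocycle2P f : cocycle2 G H G f -> forall g h k x y, g \in G -> h \in G -> k \in G ->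
  R (f h k) (g x) - R (f (g * h)%g k) x + (R (f g (h * k)%g) x - R (f g h) x) =
  R (f h k) (g y) - R (f (g * h)%g k) y + (R (f g (h * k)%g) y - R (f g h) y).
Proof.
move=> fc g h k x y gG hG kG; have /JeqPr/(_ x y) := fc g h k gG hG kG.
rewrite /Jadd /Jsub /Jact /J0 !subr0 !coset_of_pointM //.
by rewrite !rmorphD !rmorphN /=.
Qed.

(** Average the cocycle identity over its third argument; the substitution of [h * k] for [k]
    removes the dependence on [h] in one term. *)
Lemma cochain_of_delta f : cocycle2 G H G f -> forall g h x y, g \in G -> h \in G ->
  cochain_of f g x + cochain_of f h (g x) - cochain_of f (g * h)%g x - R (f g h) x =
  cochain_of f g y + cochain_of f h (g y) - cochain_of f (g * h)%g y - R (f g h) y.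
Proof.
move=> fc g h x y gG hG.
have N0 : #|G|%:R != 0 :> rat by rewrite pnatr_eq0 -lt0n cardG_gt0.
have E u : cochain_of f g u + cochain_of f h (g u) - cochain_of f (g * h)%g u - R (f g h) u =
   #|G|%:R^-1 * \sum_(k in G) (R (f h k) (g u) - R (f (g * h)%g k) u + (R (f g (h * k)%g) u - R
       (f g h) u)).
  rewrite big_split /= !sumrB sumr_const.
  have -> : \sum_(k in G) R (f g (h * k)%g) u = \sum_(k in G) R (f g k) u.
    rewrite [RHS](reindex_inj (mulgI h)) /=; apply: eq_bigl => k.
    by rewrite groupMl.
  by rewrite /cochain_of -mulr_natl; field.
by rewrite !E; congr (_ * _); apply: eq_bigr => k kG; apply: cocycle2P.
Qed.

Lemma cochain_of_cocycle1 f : cocycle2 G H G f -> cocycle1 G (cochain_of f).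
Proof.
move=> fc g h gG hG x y; have E := cochain_of_delta fc x y gG hG.
apply: (@int_eq (R (f g h) y - R (f g h) x)); first by rewrite rpredB ?intr_int.
have -> : R (f g h) y = cochain_of f g y + cochain_of f h (g y) - cochain_of f (g * h)%g y -
  (cochain_of f g x + cochain_of f h (g x) - cochain_of f (g * h)%g x - R (f g h) x).
  by rewrite E; ring.
by ring.
Qed.

(** If [f] bounds an integral [c], then [cochain_of f - c] is a rational cocycle modulo constants, a
    coboundary by averaging over [D]. Conversely, a twist that is constant modulo Z becomes integral
    on subtracting its value at [x0], and then bounds [f]. *)
Lemma coboundary_cochain_of f (D : {group {perm X}}) : D \subset G -> cocycle2 G H G f ->
  (coboundary2 G H D f <-> coboundary1 D (cochain_of f)).
Proof.
move=> /subsetP sD fc; pose m := cochain_of f; split.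
  move=> [c cE]; pose b g x := m g x - R (c g) x.
  have [|phi phiE] := @average1 X D b.
    move=> g h gD hD x y; have gG := sD _ gD; have hG := sD _ hD.
    have E := cochain_of_delta fc x y gG hG.
    have /JeqPr/(_ x y) := cE g h gD hD.
    rewrite /Jadd /Jsub /Jact !coset_of_pointM // !rmorphD !rmorphN /= => E2.
    move: E E2; rewrite -/m /b => E E2.
    by lra.
  have phiE' g : g \in D -> forall x y, twist m phi g x - R (c g) x = twist m phi g y - R (c g) y.
    by move=> gD x y; have := phiE g gD x y; rewrite /twist /b; lra.
  exists phi => g gD x y; apply: (@int_eq (R (c g) x - R (c g) y)); first by rewrite rpredB
      ?intr_int.
  by have := phiE' g gD x y; rewrite /twist -/m; lra.
move=> [phi phiE].
pose n g x := Num.floor (twist m phi g x - twist m phi g x0).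
have nE g x : g \in D -> (n g x)%:~R = twist m phi g x - twist m phi g x0.
  by move=> gD; apply: floorK; apply: phiE.
exists (fun g C => n g (point_of_coset C)) => g h gD hD.
have gG := sD _ gD; have hG := sD _ hD.
apply/JeqPr => x y; have E := cochain_of_delta fc x y gG hG.
rewrite /Jadd /Jsub /Jact !coset_of_pointM // !coset_of_pointK !rmorphD !rmorphN /=.
rewrite !nE ?groupM // /twist !permM; move: E; rewrite -/m; lra.
Qed.

(* Every rational 1-cocycle m modulo Z and constants comes from the integral
   2-cocycle [delta m - (delta m)(x0)]. *)
Lemma cochain_of_surj m : cocycle1 G m -> exists2 f, cocycle2 G H G f &
  exists phi, forall g, g \in G -> forall x y, twist (cochain_of f) phi g x - m g x = twist
      (cochain_of f) phi g y - m g y.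
Proof.
move=> mc; pose d g h x := m g x + m h (g x) - m (g * h)%g x.
pose f : cochain2 {perm X} := fun g h C => Num.floor (d g h (point_of_coset C) - d g h x0).
have fE g h x : g \in G -> h \in G -> R (f g h) x = d g h x - d g h x0.
  move=> gG hG; rewrite /f coset_of_pointK floorK //.
  by apply: (int_eq (int_opp (mc g h gG hG x x0))); rewrite /d; ring.
have fc : cocycle2 G H G f.
  move=> g h k gG hG kG; apply/JeqPr => x y.
  rewrite /Jadd /Jsub /Jact /J0 !coset_of_pointM // !rmorphD !rmorphN /=.
  by rewrite !fE ?groupM // /d !permM !mulgA; lra.
exists f => //; pose b g x := cochain_of f g x - m g x.
have [|phi phiE] := @average1 X G b.
  move=> g h gG hG x y; have := cochain_of_delta fc x y gG hG.
  by rewrite !fE // /d /b; lra.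
by exists phi => g gG x y; have := phiE g gG x y; rewrite /twist /b; lra.
Qed.

End Translation.

Lemma card_transitive_stab (X : finType) (G H : {group {perm X}}) x0 :
  [transitive G, on [set: X] | 'P] -> H :=: ('C_G[x0 | 'P])%g -> #|G| = (#|X| * #|H|)%N.
Proof.
move=> tr HE; rewrite HE -(card_orbit_stab 'P G x0); congr (_ * _)%N.
rewrite -cardsT; apply: eq_card => x; rewrite inE.
by have [g gG <-] := transitive_perm_ex x0 tr x; rewrite -apermE mem_orbit.
Qed.

Lemma exp_fpD (gT : finGroupType) p (x : gT) (a b : 'F_p) : prime p -> (x ^+ p = 1)%g ->
  (x ^+ (a + b)%R = x ^+ a * x ^+ b)%g.
Proof.
move=> pr xp; rewrite -expgD -(expg_mod (a + b)%N xp).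
by congr (_ ^+ _)%g; rewrite /= [X in (_ %% X)%N]Fp_cast.
Qed.

(* z generates a central subgroup of order p, which is semiregular; V = H<z> has
   index p, and t is any element outside V.  The point F a b is x0 t^a z^b. *)
Lemma coordinates_exist p (X : finType) (G : {group {perm X}}) (x0 : X) : prime p ->
  p.-group G -> [transitive G, on [set: X] | 'P] -> #|X| = (p ^ 2)%N ->
  exists z t i j c e F, @coordinates p X G z t i j c e F /\
    F 0 0 = x0 /\ ((t ^+ p)%g = 1%g -> forall a, e t a = 0).
Proof.
move=> pr pG tr cX; pose H := ('C_G[x0 | 'P])%G.
have HE : H :=: ('C_G[x0 | 'P])%g by [].
have cG := card_transitive_stab tr HE; rewrite cX in cG.
have memH g := mem_stab HE g.
have ntG : G :!=: 1%g.
  apply/eqP => G1; have := cG; rewrite G1 cards1 => /esym/eqP.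
  by rewrite -mulnn !muln_eq1 => /andP[/andP[/eqP p1 _] _]; rewrite p1 in pr.
have pZ : (p %| #|'Z(G)%g|)%N.
  have /(pgroup_pdiv (pgroupS (center_sub G) pG))[] // : ('Z(G))%g != 1%g.
  by rewrite (center_nil_eq1 (pgroup_nil pG)).
have [z zZ oz] := Cauchy pr pZ.
have /centerP[zG zC] := zZ.
have zp : (z ^+ p = 1)%g by rewrite -oz expg_order.
(* A power of the central [z] fixing one point fixes its whole orbit under [G], that is, every
   point. *)
have zX_free n : (z ^+ n)%g x0 = x0 -> (z ^+ n = 1)%g.
  move=> zn; apply/permP => x; have [g gG <-] := transitive_perm_ex x0 tr x.
  have cgz : (g * z ^+ n = z ^+ n * g)%g by apply: commuteX; apply/esym/zC.
  by rewrite -permM cgz permM zn perm1.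
have tiH : H :&: <[z]>%g = 1%g.
  apply/trivgP/subsetP => g /setIP[]; rewrite memH => /andP[_ /eqP g0] /cycleP[n gE].
  by rewrite inE gE zX_free // -gE.
have sHG : H \subset G by apply: subsetIl.
have szG : <[z]>%g \subset G by rewrite cycle_subG.
have czH : <[z]>%g \subset ('C(H))%g.
  by rewrite cycle_subG; apply/centP => h hH; apply: zC; apply: (subsetP sHG).
pose V := (H <*> <[z]>)%G.
have VE : V :=: (H * <[z]>)%g by apply: cent_joinEr.
have cV : #|V| = (#|H| * p)%N by rewrite VE TI_cardMg // -oz.
have sVG : V \subset G by rewrite join_subG sHG.
have iV : #|G : V|%g = p.
  rewrite -divgS // cG cV expnS expn1 -mulnA (mulnC p #|H|).
  by rewrite mulnK // muln_gt0 cardG_gt0 prime_gt0.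
have nV : V <| G.
  by apply: (p_maximal_normal pG); apply: p_index_maximal; rewrite ?iV.
have [t tG tV] : exists2 t, t \in G & t \notin V.
  by apply/subsetPn; rewrite -indexg_eq1 iV neq_ltn prime_gt1 ?orbT.
have nVG : G \subset ('N(V))%g by apply: normal_norm.
have cq : #|(G / V)%g| = p by rewrite card_quotient // iV.
pose q := coset V.
have qM g h : g \in G -> h \in G -> q (g * h)%g = (q g * q h)%g.
  by move=> gG hG; rewrite /q morphM // (subsetP nVG).
have q1 g : g \in V -> q g = 1%g by apply: coset_id.
have oqt : #[q t]%g = p.
  have := order_dvdG (mem_quotient V tG); rewrite cq => /(primeP pr).2 /orP[|/eqP //].
  rewrite order_eq1 => /eqP/coset_idr tV'.
  by rewrite tV' ?(subsetP nVG) in tV.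
have qtp : (q t ^+ p = 1)%g by rewrite -oqt expg_order.
have qgen g : g \in G -> exists k : 'F_p, q g = (q t ^+ k)%g.
  move=> gG; have : q g \in <[q t]>%g.
    suff <- : (G / V)%g = <[q t]>%g by apply: mem_quotient.
    by apply/esym/eqP; rewrite eqEcard cycle_subG mem_quotient //= cq -oqt leqnn.
  case/cycleP => n ->; exists n%:R.
  by rewrite val_Fp_nat // expg_mod.
have qinj (a b : 'F_p) : (q t ^+ a = q t ^+ b)%g -> a = b.
  move/eqP; rewrite eq_expg_mod_order oqt !modn_small ?fp_lt // => /eqP h.
  exact: val_inj.
pose c g : 'F_p := odflt 0 [pick k : 'F_p | q g == (q t ^+ k)%g].
have cE g : g \in G -> q g = (q t ^+ c g)%g.
  move=> gG; rewrite /c; case: pickP => [k /eqP //|none].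
  by have [k qk] := qgen g gG; have := none k; rewrite qk eqxx.
have qz : q z = 1%g by apply: q1; apply: (subsetP (joing_subr _ _)); apply: cycle_id.
pose F (a b : 'F_p) : X := (t ^+ a * z ^+ b)%g x0.
have qX g n : g \in G -> q (g ^+ n)%g = (q g ^+ n)%g.
  by move=> gG; rewrite /q morphX // (subsetP nVG).
have qtX n : q (t ^+ n)%g = (q t ^+ n)%g by apply: qX.
have qzX n : q (z ^+ n)%g = 1%g by rewrite qX // qz expg1n.
have mG (a b : 'F_p) : (t ^+ a * z ^+ b)%g \in G by rewrite groupM ?groupX.
have qF (a b : 'F_p) : q (t ^+ a * z ^+ b)%g = (q t ^+ a)%g.
  by rewrite qM ?groupX // qtX qzX mulg1.
(* Elements with the same value at [x0] differ by an element of H, which lies in V; so the image in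
   G/V depends on the point alone and defines the coordinate [i]. *)
have qpt g h : g \in G -> h \in G -> g x0 = h x0 -> q g = q h.
  move=> gG hG gh; have ghH : (g * h^-1)%g \in H.
    by rewrite memH groupM ?groupV //= permM gh permK.
  rewrite -[g](mulgKV h) qM ?groupM ?groupV // (q1 (g * h^-1)%g) ?mul1g //.
  exact: (subsetP (joing_subl _ _)).
have zinj (a b : 'F_p) : (z ^+ a = z ^+ b)%g -> a = b.
  move/eqP; rewrite eq_expg_mod_order oz !modn_small ?fp_lt // => /eqP h.
  exact: val_inj.
have FD a b d : F a (b + d) = (z ^+ d)%g (F a b).
  by rewrite /F exp_fpD // mulgA permM.
have Finj : injective (fun ab : 'F_p * 'F_p => F ab.1 ab.2).
  move=> [a b] [a' b'] /= hF.
  have aa : a = a' by apply: qinj; rewrite -(qF a b) -(qF a' b'); apply: qpt.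
  rewrite -aa in hF *; congr (_, _); apply: zinj.
  have h2 : (z ^+ b * (z ^+ b')^-1 = 1)%g.
    pose d := (b - b'); have hd : (z ^+ d)%g x0 = x0.
      have : (z ^+ d)%g (F a b') = F a b' by rewrite -FD addrC subrK.
      rewrite /F -permM => h; apply: (@perm_inj _ (t ^+ a * z ^+ b')%g).
      rewrite -[LHS]permM -[in RHS]h; congr (fun_of_perm _ x0).
      by apply/esym/commuteX/esym/zC.
    have zb : (z ^+ b = z ^+ (b - b')%R * z ^+ b')%g by rewrite -exp_fpD // subrK.
    by rewrite zb mulgK; apply: zX_free hd.
  by apply/eqP; rewrite eq_mulgV1 h2.
have [G0 G0F FG0] : bijective (fun ab : 'F_p * 'F_p => F ab.1 ab.2).
  by apply: inj_card_bij => //; rewrite card_prod !card_Fp // cX mulnn.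
pose i x := (G0 x).1; pose j x := (G0 x).2.
have iF a b : i (F a b) = a by rewrite /i (G0F (a, b)).
have jF a b : j (F a b) = b by rewrite /j (G0F (a, b)).
have Fij x : F (i x) (j x) = x by apply: FG0.
pose e (g : {perm X}) a := j (g (F a 0)).
have ij_g g x : g \in G -> i (g x) = i x + c g.
  move=> gG.
  have h : q (t ^+ i (g x) * z ^+ j (g x))%g = q (t ^+ i x * z ^+ j x * g)%g.
    apply: qpt; rewrite ?groupM ?groupX // [RHS]permM.
    by change (F (i (g x)) (j (g x)) = g (F (i x) (j x))); rewrite !Fij.
  by apply: qinj; rewrite exp_fpD // -cE // -(qF _ (j (g x))) h qM // qF.
have jz y d : j ((z ^+ (d : 'F_p))%g y) = j y + d.
  by rewrite -{1}(Fij y) -FD jF.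
exists z, t, i, j, c, e, F; split; first split=> //.
- move=> g x gG; rewrite -{1}(Fij x) -[j x in LHS]add0r FD /e.
  rewrite -permM (_ : _ * g = g * z ^+ (j x : nat))%g; last by apply/esym/commuteX/esym/zC.
  by rewrite permM jz addrC.
- by apply: qinj; rewrite -cE // qz.
- move=> a; rewrite /e; have := jz (F a 0) 1; rewrite jF add0r => <-.
  by congr (j (fun_of_perm _ _)); rewrite expg1.
- apply: qinj; rewrite -cE // expg1.
- split=> //; first by rewrite /F !expg0 mulg1 perm1.
  (* The exponent of [t] in [F] is a residue, so going from [F a 0] to [F (a + 1) 0] by [t] needs
     [t ^+ p = 1] at the wrap-around. *)
  move=> tp a; rewrite /e /F expg0 mulg1 -permM.
  rewrite (_ : t ^+ a * t = t ^+ (a + 1)%R * z ^+ (0%R : 'F_p))%g ?jF //.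
  rewrite expg0 mulg1 exp_fpD // expg1.
Qed.

(** * The groups P'_1 and P'_2 *)

Section PprimeStructure.
Variables (p : nat) (pr : prime p) (p2 : (2 < p)%N).
Local Notation Y := ('F_p * 'F_p)%type.

Lemma shiftpE (b : 'F_p -> 'F_p) x : shiftp b x = (x.1, x.2 + b x.1).
Proof. by rewrite permE. Qed.

Lemma eq_shiftp (b b' : 'F_p -> 'F_p) : b =1 b' -> shiftp b = shiftp b'.
Proof. by move=> bb; apply/permP => x; rewrite !shiftpE bb. Qed.

Lemma shiftpM (b b' : 'F_p -> 'F_p) : (shiftp b * shiftp b')%g = shiftp (fun k => b k + b' k).
Proof. by apply/permP => x; rewrite permM !shiftpE /= addrA. Qed.

Lemma shiftp0 : shiftp (fun=> 0 : 'F_p) = 1%g.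
Proof. by apply/permP => -[a b]; rewrite shiftpE perm1 /= addr0. Qed.

Lemma shiftpX (b : 'F_p -> 'F_p) n : (shiftp b ^+ n)%g = shiftp (fun k => b k *+ n).
Proof.
elim: n => [|n IH]; first by rewrite expg0 -shiftp0; apply: eq_shiftp.
by rewrite expgSr IH shiftpM; apply: eq_shiftp => k; rewrite mulrSr.
Qed.

Lemma shiftpV (b : 'F_p -> 'F_p) : (shiftp b)^-1%g = shiftp (fun k => - b k).
Proof.
apply/eqP; rewrite eq_invg_mul shiftpM -shiftp0; apply/eqP; apply: eq_shiftp => k.
by rewrite subrr.
Qed.

Lemma zE (i0 : 'F_p) : z i0 = shiftp (fun k => (k == i0)%:R).
Proof.
apply/permP => -[a b]; rewrite shiftpE permE /z_fun /=.
by case: eqP => _; rewrite ?addr0.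
Qed.

Lemma zpowpE (i0 : 'F_p) (a : int) : zpowp (z i0) a = shiftp (fun k => (k == i0)%:R *~ a).
Proof.
rewrite zE; case: a => n /=; first by rewrite shiftpX.
by rewrite shiftpV shiftpX; apply: eq_shiftp => k; rewrite NegzE mulrNz mulNrn.
Qed.

Lemma gammapE n : gammap p n = shiftp (fun k : 'F_p => (acoef (p - n) k)%:~R).
Proof.
rewrite /gammap.
have -> : (\prod_(j < p) zpowp (z (j%:R : 'F_p)) (acoef (p - n) j))%g =
   shiftp (fun k : 'F_p => \sum_(j < p) (k == j%:R)%:R *~ acoef (p - n) j).
  have gen N (a : nat -> int) : (\prod_(j < N) zpowp (z (j%:R : 'F_p)) (a j))%g =
    shiftp (fun k : 'F_p => \sum_(j < N) (k == j%:R)%:R *~ a j).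
    elim: N => [|N IH].
      by rewrite big_ord0 -shiftp0; apply: eq_shiftp => k; rewrite big_ord0.
    rewrite big_ord_recr /= IH zpowpE shiftpM; apply: eq_shiftp => k.
    by rewrite big_ord_recr.
  exact: gen.
apply: eq_shiftp => k.
rewrite (bigD1 (Ordinal (fp_lt pr k))) //= natr_fp eqxx big1 ?addr0 // => j jk.
rewrite -[k in k == _]natr_fp; case: eqP => [e|_]; last by rewrite mul0rz.
case/eqP: jk; apply: val_inj => /=.
by have := congr1 val e; rewrite /= !val_Fp_nat // !modn_small // fp_lt.
Qed.

(** Pascal's rule with p dividing C(p, j + 1). The signs in [acoef] then make all coefficients of
    [gammap p 1] equal to 1. *)
Lemma bin_p1 j : (j < p)%N -> 'C(p.-1, j)%:R = (-1) ^+ j :> 'F_p.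
Proof.
elim: j => [|j IH] jp; first by rewrite bin0.
have := binS p.-1 j; rewrite prednK ?prime_gt0 // => /(congr1 (fun n => n%:R : 'F_p)).
have -> : 'C(p, j.+1)%:R = 0 :> 'F_p.
  by apply/eqP; rewrite natr_fp_eq0 // prime_dvd_bin.
by rewrite natrD IH ?(ltnW jp) // exprS mulN1r => /esym/eqP; rewrite addr_eq0 => /eqP.
Qed.

Lemma bin_p2 j : (j < p.-1)%N -> 'C(p.-2, j)%:R = (-1) ^+ j * j.+1%:R :> 'F_p.
Proof.
elim: j => [|j IH] jp; first by rewrite bin0 mulr1.
have := binS p.-2 j; rewrite prednK; last by rewrite -ltnS prednK ?prime_gt0 // prime_gt1.
move=> /(congr1 (fun n => n%:R : 'F_p)).
rewrite bin_p1 ?(leq_trans jp (leq_pred p)) // natrD IH ?(ltnW jp) //.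
move=> /eqP; rewrite -subr_eq => /eqP <-.
by rewrite exprS -[j.+2]addn1 natrD; ring.
Qed.

Lemma signr_p1 : (-1) ^+ p.-1 = 1 :> 'F_p.
Proof.
rewrite -signr_odd; have [pE|op] := even_prime pr; first by move: p2; rewrite pE.
by move: op; rewrite -{1}(prednK (prime_gt0 pr)) /= => /negbTE ->.
Qed.

Lemma gamma1 : gammap p 1 = rho1 p.
Proof.
rewrite gammapE; apply/permP => x; rewrite shiftpE permE /rho1_fun.
have xp : (x.1 < p)%N by apply: fp_lt.
have xp1 : (x.1 <= p.-1)%N by rewrite -ltnS prednK ?prime_gt0.
rewrite /acoef subn1 xp1 rmorphM rmorphXn rmorphN1 /= -pmulrn bin_p1 //.
by rewrite -exprD subnK // signr_p1.
Qed.

Lemma gamma2 : gammap p 2 = shiftp (fun k : 'F_p => - (k + 1)).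
Proof.
rewrite gammapE; apply: eq_shiftp => k.
have kp : (k < p)%N by apply: fp_lt.
rewrite /acoef subn2; case: ifP => [kp2|/negbT].
  have kp1 : (k < p.-1)%N.
    rewrite (leq_ltn_trans kp2) // -ltnS prednK //.
    by rewrite -ltnS prednK ?prime_gt0 // prime_gt1.
  rewrite rmorphM rmorphXn rmorphN1 /= -pmulrn bin_p2 //.
  rewrite mulrA -exprD subnK // -natr1 natr_fp.
  suff -> : (-1) ^+ p.-2 = -1 :> 'F_p by rewrite mulN1r.
  have := signr_p1; rewrite -[p.-1]prednK; last by rewrite -ltnS prednK ?prime_gt0 // prime_gt1.
  by rewrite exprS mulN1r => h; rewrite -[LHS]opprK h.
(* Only the fibre k = p - 1 remains: there the coefficient is 0 by convention, in accordance with k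
   + 1 = 0. *)
rewrite -ltnNge => kp2.
have kE : ((k : nat) + 1 = p)%N.
  apply/eqP; rewrite eqn_leq addn1 kp /=.
  have e2 : p.-2.+1 = p.-1 by rewrite prednK // -ltnS prednK ?prime_gt0 // prime_gt1.
  apply: (@leq_trans p.-1.+1); first by rewrite prednK ?prime_gt0.
  by rewrite ltnS -e2.
have -> : k + 1 = 0.
  by apply/eqP; rewrite -(natr_fp k) natr1 natr_fp_eq0 // -[X in (_ %| X)%N]addn1 kE.
by rewrite oppr0.
Qed.

(** These maps form the Heisenberg group over ['F_p]. It contains P'_1 and P'_2, so its exponent and
    order bound theirs. *)
Definition affine_perm (u : 'F_p * 'F_p * 'F_p) (x : Y) : Y :=
  (x.1 + u.1.1, x.2 + u.1.2 * x.1 + u.2).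

Lemma affine_perm_inj u : injective (affine_perm u).
Proof.
case=> a b [a' b']; rewrite /affine_perm /= => h.
have h1 := congr1 fst h; have h2 := congr1 snd h; rewrite /= in h1 h2.
have aa : a = a' by apply: (addIr u.1.1).
by rewrite aa in h2 *; congr (_, _); apply: (addIr (u.1.2 * a')); apply: (addIr u.2).
Qed.

Arguments affine_perm_inj : clear implicits.

Definition affine_set := [set perm (affine_perm_inj u) | u : 'F_p * 'F_p * 'F_p].

Lemma affineM u v : (perm (affine_perm_inj u) * perm (affine_perm_inj v))%g =
  perm (affine_perm_inj (u.1.1 + v.1.1, u.1.2 + v.1.2, u.2 + v.2 + v.1.2 * u.1.1)).
Proof. by apply/permP => x; rewrite permM !permE /affine_perm /=; congr (_, _); ring. Qed.

Lemma affine_group_set : group_set affine_set.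
Proof.
apply/group_setP; split.
  apply/imsetP; exists (0, 0, 0) => //; apply/permP => -[a b].
  by rewrite perm1 permE /affine_perm /= mul0r !addr0.
by move=> _ _ /imsetP[u _ ->] /imsetP[v _ ->]; rewrite affineM imset_f.
Qed.

Definition affine_group := Group affine_group_set.

Lemma card_affine_group : (#|affine_group| <= p ^ 3)%N.
Proof. by rewrite (leq_trans (leq_imset_card _ _)) // !card_prod !card_Fp // -mulnA. Qed.

Lemma affineX u n : (perm (affine_perm_inj u) ^+ n)%g =
  perm (affine_perm_inj (u.1.1 *+ n, u.1.2 *+ n, u.2 *+ n + u.1.2 * u.1.1 * 'C(n, 2)%:R)).
Proof.
elim: n => [|n IH].
  rewrite expg0; apply/permP => -[a b]; rewrite perm1 permE /affine_perm /=.
  by rewrite !(mulr0n, mul0r, mulr0, addr0).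
rewrite expgSr IH affineM /= binS bin1 natrD.
congr (perm (affine_perm_inj _)); congr (_, _, _); rewrite ?mulrSr //.
by rewrite -(mulr_natr _ n) -[u.1.1 *+ n]mulr_natr; ring.
Qed.

Lemma affine_expp s : s \in affine_group -> (s ^+ p = 1)%g.
Proof.
case/imsetP => u _ ->; rewrite affineX; apply/permP => -[a b].
have p0 (w : 'F_p) : w *+ p = 0.
  by rewrite -mulr_natr (eqP (_ : p%:R == 0 :> 'F_p)) ?mulr0 ?natr_fp_eq0.
have -> : 'C(p, 2)%:R = 0 :> 'F_p.
  by apply/eqP; rewrite natr_fp_eq0 // prime_dvd_bin // p2.
by rewrite perm1 permE /affine_perm /= !p0 mulr0 mul0r !addr0.
Qed.

Lemma rho1_affine : rho1 p = perm (affine_perm_inj (0, 0, 1)).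
Proof. by apply/permP => -[a b]; rewrite !permE /rho1_fun /affine_perm /= mul0r !addr0. Qed.

Lemma rho2_affine : rho2 p = perm (affine_perm_inj (1, 0, 0)).
Proof. by apply/permP => -[a b]; rewrite !permE /rho2_fun /affine_perm /= mul0r !addr0. Qed.

Lemma gamma2_affine : gammap p 2 = perm (affine_perm_inj (0, -1, -1)).
Proof.
rewrite gamma2; apply/permP => -[a b]; rewrite shiftpE permE /affine_perm /= addr0.
by congr (_, _); ring.
Qed.

Lemma Pprime_affine n : (n == 1)%N || (n == 2)%N -> Pprime p n \subset affine_group.
Proof.
move=> n12; rewrite gen_subG; apply/subsetP => s; rewrite !inE => /orP[/orP[]|] /eqP ->.
- by rewrite rho1_affine imset_f.
- by rewrite rho2_affine imset_f.
- by case/orP: n12 => /eqP ->; rewrite ?gamma1 ?rho1_affine ?gamma2_affine imset_f.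
Qed.

Lemma Pprime_exponent n : (n == 1)%N || (n == 2)%N -> (exponent (Pprime p n) %| p)%N.
Proof.
move=> n12; apply/exponentP => s /(subsetP (Pprime_affine n12)); exact: affine_expp.
Qed.

Lemma Pprime_pgroup n : (n == 1)%N || (n == 2)%N -> p.-group (Pprime p n).
Proof.
move=> n12; rewrite -pnat_exponent.
by apply: pnat_dvd (Pprime_exponent n12) _; rewrite pnat_id.
Qed.

Lemma Pprime1_abelian : abelian (Pprime p 1).
Proof.
have c12 : commute (rho1 p) (rho2 p).
  by rewrite /commute rho1_affine rho2_affine !affineM /=; congr (perm (affine_perm_inj _));
      congr (_, _, _); ring.
rewrite abelian_gen; apply/centsP => s sS u uS.
have c s' : s' \in [set rho1 p; rho2 p; gammap p 1] -> s' = rho1 p \/ s' = rho2 p.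
  by rewrite !inE gamma1 => /orP[/orP[]|] /eqP ->; auto.
by case: (c s sS) => ->; case: (c u uS) => ->; rewrite // /commute -?c12.
Qed.

Lemma card_Pprime1 : #|Pprime p 1| = (p ^ 2)%N.
Proof.
have r1 : rho1 p \in Pprime p 1 by rewrite mem_gen // !inE eqxx.
have r2 : rho2 p \in Pprime p 1 by rewrite mem_gen // !inE eqxx orbT.
pose f (u : Y) := (rho2 p ^+ u.1 * rho1 p ^+ u.2)%g.
have fE u : f u = perm (affine_perm_inj (u.1, 0, u.2)).
  rewrite /f rho1_affine rho2_affine !affineX affineM /=.
  by congr (perm (affine_perm_inj _)); rewrite !natr_fp !(mul0rn, mul0r, mulr0, addr0, add0r).
have finj : injective f.
  move=> [a b] [a' b']; rewrite !fE /= => /(congr1 (fun s : {perm Y} => s (0, 0))).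
  by rewrite !permE /affine_perm /= !mul0r !add0r.
have -> : Pprime p 1 = (f @: setT) :> {set _}.
  apply/eqP; rewrite eqEsubset; apply/andP; split; last first.
    by apply/subsetP => _ /imsetP[u _ ->]; rewrite groupM // groupX.
  have gs : group_set (f @: setT).
    apply/group_setP; split.
      by apply/imsetP; exists (0, 0); rewrite // /f !expg0 mulg1.
    move=> _ _ /imsetP[u _ ->] /imsetP[v _ ->]; apply/imsetP.
    exists (u.1 + v.1, u.2 + v.2) => //; rewrite !fE affineM /=.
    by congr (perm (affine_perm_inj _)); congr (_, _, _); ring.
  rewrite (gen_subG _ (Group gs)); apply/subsetP => s.
  rewrite !inE gamma1 => /orP[/orP[]|] /eqP -> /=; apply/imsetP.
  - by exists (0, 1); rewrite // fE rho1_affine.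
  - by exists (1, 0); rewrite // fE rho2_affine.
  - by exists (0, 1); rewrite // fE rho1_affine.
by rewrite card_imset // cardsT card_prod card_Fp // mulnn.
Qed.

Lemma Pprime2_nonabelian : ~~ abelian (Pprime p 2).
Proof.
have r2 : rho2 p \in Pprime p 2 by rewrite mem_gen // !inE eqxx orbT.
have g2 : gammap p 2 \in Pprime p 2 by rewrite mem_gen // !inE eqxx !orbT.
apply/negP => /centsP/(_ _ r2 _ g2); rewrite /commute rho2_affine gamma2_affine !affineM /=.
move/(congr1 (fun s : {perm Y} => (s (0, 0)).2)); rewrite !permE /affine_perm /= => /eqP.
rewrite !(mulr0, mul0r, addr0, add0r, mulr1).
by rewrite -subr_eq0 addrK oppr_eq0 oner_eq0.
Qed.

(** The order is a power of p, at most p^3 inside the affine group, and exceeds p^2 because groups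
    of order at most p^2 are abelian. *)
Lemma card_Pprime2 : #|Pprime p 2| = (p ^ 3)%N.
Proof.
have n2 : (2 == 1)%N || (2 == 2)%N by [].
have [k kE] := p_natP (Pprime_pgroup n2); rewrite kE; congr (_ ^ _)%N.
apply/eqP; rewrite eqn_leq; apply/andP; split.
  rewrite -(leq_exp2l (m := p)) ?prime_gt1 // -kE.
  exact: leq_trans (subset_leq_card (Pprime_affine n2)) card_affine_group.
rewrite ltnNge; apply: contra Pprime2_nonabelian => k2.
by apply: (@p2group_abelian _ p); rewrite ?Pprime_pgroup // kE pfactorK.
Qed.

Lemma extraspecial_p3 (gT : finGroupType) (G : {group gT}) : #|G| = (p ^ 3)%N -> ~~ abelian G ->
  extraspecial G.
Proof.
move=> cG nG; apply: (@p3group_extraspecial p) => //; first by rewrite /pgroup cG pnatX pnat_id.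
by rewrite cG pfactorK.
Qed.

Lemma isog_Pprime1 (gT : finGroupType) (G : {group gT}) : #|G| = (p ^ 2)%N -> (exponent G %| p)%N ->
  G \isog Pprime p 1.
Proof.
move=> cG eG; have abG : p.-abelem G by rewrite abelemE // eG (card_p2group_abelian pr).
by rewrite (isog_abelem_card _ abG) abelemE // Pprime1_abelian Pprime_exponent // card_Pprime1 cG
    /=.
Qed.

Lemma isog_Pprime2 (gT : finGroupType) (G : {group gT}) : #|G| = (p ^ 3)%N -> ~~ abelian G ->
  (exponent G %| p)%N -> G \isog Pprime p 2.
Proof.
move=> cG nG eG; apply: isog_trans (isog_pX1p2 pr (extraspecial_p3 cG nG) eG cG) _.
rewrite isog_sym; apply: (isog_pX1p2 pr); rewrite ?card_Pprime2 ?Pprime_exponent //.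
by apply: extraspecial_p3; rewrite ?card_Pprime2 ?Pprime2_nonabelian.
Qed.

End PprimeStructure.

Lemma coboundary1_eq (X : finType) (D : {group {perm X}}) (m m' : {perm X} -> X -> rat) :
  (forall g, g \in D -> forall x y, m g x - m' g x = m g y - m' g y) ->
  coboundary1 D m -> coboundary1 D m'.
Proof.
move=> mm [phi h]; exists phi => g gD x y.
by apply: (int_eq (h g gD x y)); have := mm g gD x y; lra.
Qed.

Lemma intr_Zp_eq0 p (n : int) : (1 < p)%N -> (n%:~R == 0 :> 'Z_p) = (p %| `|n|)%N.
Proof.
move=> p1; have nat_eq0 k : (k%:R == 0 :> 'Z_p) = (p %| k)%N.
  by rewrite -(inj_eq val_inj) /= val_Zp_nat // /dvdn.
case: n => k; first exact: nat_eq0.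
by rewrite NegzE mulrNz oppr_eq0 abszN; apply: nat_eq0.
Qed.

Lemma floor_int_Zp_eq0 p (r : rat) : (1 < p)%N -> p%:R * r \is a Num.int ->
  ((Num.floor (p%:R * r))%:~R = 0 :> 'Z_p) <-> r \is a Num.int.
Proof.
move=> p1 pr; have p0 : p%:R != 0 :> rat by rewrite pnatr_eq0 -lt0n ltnW.
have := floorK pr; set n := Num.floor _ => nE; split.
  move/eqP; rewrite intr_Zp_eq0 // => /dvdnP[k kE].
  have -> : r = (-1) ^+ (n < 0)%R * k%:R.
    apply: (mulfI p0); rewrite -nE {1}[n]intEsign kE rmorphM rmorphXn rmorphN1 /= -pmulrn natrM.
    by rewrite [RHS]mulrCA [p%:R * _]mulrC.
  by rewrite rpredM ?rpredX ?rpredN ?rpred1 ?natr_int.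
move=> rI; have nn : n = p%:Z * Num.floor r.
  by apply: (@intr_inj rat); rewrite nE rmorphM /= floorK.
by rewrite nn rmorphM /= -pmulrn pchar_Zp // mul0r.
Qed.

(** * Both parts of the theorem in coordinates *)

Section Main.
Variables (p : nat) (X : finType) (G H : {group {perm X}}) (x0 : X).
Hypotheses (pr : prime p) (p2 : (2 < p)%N).
Hypothesis tr : [transitive G, on [set: X] | 'P].
Hypothesis HE : H :=: ('C_G[x0 | 'P])%g.
Hypothesis pG : p.-group G.
Hypothesis cX : #|X| = (p ^ 2)%N.

Let cG : #|G| = (p ^ 2 * #|H|)%N.
Proof. by rewrite (card_transitive_stab tr HE) cX. Qed.

Section WithCoordinates.
Variables (z t : {perm X}) (i j : X -> 'F_p) (c : {perm X} -> 'F_p).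
Variables (e : {perm X} -> 'F_p -> 'F_p) (F : 'F_p -> 'F_p -> X).
Hypothesis cd : coordinates G z t i j c e F.
Hypothesis F00 : F 0 0 = x0.
Let zG := coord_z cd.
Let tG := coord_t cd.

Let HP h : h \in H -> [/\ h \in G, c h = 0 & e h 0 = 0].
Proof.
rewrite (mem_stab HE) => /andP[hG /eqP]; rewrite -F00 => hF; split=> //.
  by have := coord_i cd (F 0 0) hG; rewrite hF (coord_iF cd) add0r => <-.
by have := coord_j cd (F 0 0) hG; rewrite hF (coord_iF cd) (coord_jF cd) add0r => <-.
Qed.

(** An abelian transitive group is regular: an element of H commuting with [t] acts alike on all
    fibres, hence trivially. *)
Lemma abelian_card : abelian G -> #|G| = (p ^ 2)%N.
Proof.
move=> /centsP abG; suff H1 : H :=: 1%g by rewrite cG H1 cards1 muln1.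
apply/trivgP/subsetP => h /HP[hG ch eh]; rewrite inE; apply/eqP.
apply: (coord_perm_inj cd hG (group1 G)) => [|a]; first by rewrite (coord_c1 cd).
by rewrite (coord_e1 cd) (commute_t_e cd _ hG ch) //; apply: abG.
Qed.

Lemma sha_agrees (Dset : {set {group {perm X}}}) f : cyclic_subgroups G \subset Dset ->
  sha_cocycle G H Dset f -> agrees_on_fix G (cochain_of G x0 f).
Proof.
move=> cDs [fc fD] g x y gG gx gy.
have sg : <[g]>%g \subset G by rewrite cycle_subG.
have [|phi h] := (coboundary_cochain_of tr HE sg fc).1.
  by apply: fD; apply: (subsetP cDs); rewrite inE sg cycle_cyclic.
have := h g (cycle_id g) x y; rewrite gx gy => hg.
by apply: (int_eq hg); ring.
Qed.

(** On H, [e h 0] vanishes, so [e h 1] determines [h] by [commutator_e01]. *)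
Lemma commutator_card_stab m : cocycle1 G m -> agrees_on_fix G m ->
  commutator_value z t F m \isn't a Num.int -> (#|H| <= p)%N.
Proof.
move=> mc mf cm; rewrite -[X in (_ <= X)%N](card_Fp pr).
have inj : {in H &, injective (fun h => e h 1)}.
  move=> h k /HP[hG ch eh] /HP[kG ck ek] hk.
  have uG : (h * k^-1)%g \in G by rewrite groupM ?groupV.
  have cu : c (h * k^-1)%g = 0 by rewrite (coord_cM cd) ?groupV // (coord_cV cd) // ch ck subrr.
  have eu a : e h a = e k a -> e (h * k^-1)%g a = 0.
    rewrite -{1}[h](mulgKV k) (coord_eM cd _ uG kG) cu addr0 => /eqP.
    by rewrite -subr_eq0 addrK => /eqP.
  have u1 := commutator_e01 pr cd mc mf cm uG cu (eu 0 (etrans eh (esym ek))) (eu 1 hk).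
  by apply/eqP; rewrite eq_mulgV1 u1.
by rewrite -(card_in_imset inj) max_card.
Qed.

Lemma commutator_isog m : cocycle1 G m -> agrees_on_fix G m ->
  commutator_value z t F m \isn't a Num.int -> (G \isog Pprime p 1) || (G \isog Pprime p 2).
Proof.
move=> mc mf cm; have eG : (exponent G %| p)%N.
  by apply/exponentP => g; apply: (commutator_expp pr cd mc mf cm).
have pH : p.-group H by apply: pgroupS pG; rewrite HE subsetIl.
have [k kE] := p_natP pH; have := commutator_card_stab mc mf cm.
rewrite kE -[X in (_ <= X)%N]expn1 leq_exp2l ?prime_gt1 //.
case: k kE => [|[|//]] cH _.
  by rewrite isog_Pprime1 // cG cH expn0 muln1.
have cG3 : #|G| = (p ^ 3)%N by rewrite cG cH -expnD.
rewrite orbC isog_Pprime2 //; apply/negP => /abelian_card; rewrite cG3 => /eqP.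
by rewrite eqn_exp2l // prime_gt1.
Qed.

Lemma sha_cyclic_trivial : ~~ ((G \isog Pprime p 1) || (G \isog Pprime p 2)) ->
  sha_trivial G H (cyclic_subgroups G).
Proof.
move=> nG f shf; have mf := sha_agrees (subxx _) shf; have [fc _] := shf.
have mc := cochain_of_cocycle1 tr HE fc.
apply/(coboundary_cochain_of tr HE (subxx G) fc).
apply: (commutator_coboundary pr cd mc mf).
by apply: contraR nG; apply: commutator_isog.
Qed.

Section Small.
Hypothesis eG : (exponent G %| p)%N.
Hypothesis cG3 : (#|G| <= p ^ 3)%N.
Hypothesis et : forall a, e t a = 0.
Variable Dset : {set {group {perm X}}}.
Hypothesis aD : admissible G Dset.

Let expp g : g \in G -> (g ^+ p = 1)%g.
Proof. by move/exponentP: eG; apply. Qed.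

Let sub_Dset (D : {group {perm X}}) : D \in Dset -> D \subset G.
Proof. by case: aD => h _ _; apply: h. Qed.

Let cyc_Dset : cyclic_subgroups G \subset Dset.
Proof. by case: aD. Qed.

Let z_order : #[z]%g = p.
Proof.
have : (#[z]%g %| p)%N by rewrite order_dvdn (zXp pr cd).
move/(primeP pr).2 => /orP[|/eqP //]; rewrite order_eq1 => /eqP z1.
by case: (z_freeP cd (x := x0)); rewrite z1 perm1.
Qed.

(** Otherwise [E] and [z] would generate an abelian group of order p^3, equal to [G], against
    [abelian_card]. *)
Lemma z_in_abelem (E : {group {perm X}}) : E \subset G -> abelian E -> #|E| = (p ^ 2)%N -> z \in E.
Proof.
move=> sE abE cE; apply: contraT => zE.
have ti : E :&: <[z]>%g = 1%g.
  by rewrite setIC; apply: prime_TIg; rewrite ?cycle_subG // -/(#[z]%g) z_order.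
have cEz : <[z]>%g \subset ('C(E))%g.
  by rewrite cycle_subG; apply/centP => h hE; apply/esym/(z_central cd)/(subsetP sE).
have GE : (E <*> <[z]>)%g = G.
  apply/eqP; rewrite eqEcard join_subG sE cycle_subG zG cent_joinEr // TI_cardMg // cE -/(#[z]%g)
      z_order.
  by rewrite -expnSr cG3.
have abG : abelian G by rewrite -GE abelianY abE cycle_abelian.
have := abelian_card abG; rewrite -GE cent_joinEr // TI_cardMg // cE -/(#[z]%g) z_order -expnSr.
by move/eqP; rewrite eqn_exp2l // prime_gt1.
Qed.

Lemma sha_trivial_abelem (D E : {group {perm X}}) : D \in Dset -> E \subset D -> p.-abelem E ->
  #|E| = (p ^ 2)%N -> sha_trivial G H Dset.
Proof.
move=> DD sED abE cE f shf; have mf := sha_agrees cyc_Dset shf; have [fc fD] := shf.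
have mc := cochain_of_cocycle1 tr HE fc; have sDG := sub_Dset DD.
apply/(coboundary_cochain_of tr HE (subxx G) fc).
apply: (commutator_coboundary pr cd mc mf).
have sEG := subset_trans sED sDG.
apply: (coboundary_abelem_commutator pr cd mc mf sEG _ cE cG3).
  by apply: z_in_abelem => //; apply: abelem_abelian abE.
apply: (coboundary1S sED); apply/(coboundary_cochain_of tr HE sDG fc).
exact: fD.
Qed.

Let comm_z g : g \in G -> exists k, (t * g = g * t * z ^+ k)%g.
Proof.
move=> gG; have nz : G \subset ('N(<[z]>))%g.
  by apply: cents_norm; rewrite centsC cycle_subG; apply/centP => h hG; apply/esym/(z_central cd).
have abq : abelian (G / <[z]>)%g.
  apply: (@p2group_abelian _ p); first exact: quotient_pgroup.
  rewrite card_quotient // -divgS ?cycle_subG // -/(#[z]%g) z_order.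
  have [k kE] := p_natP pG.
  have k3 : (k <= 3)%N by rewrite -(leq_exp2l (m := p)) ?prime_gt1 // -kE.
  rewrite logn_div; last by rewrite -z_order order_dvdG.
  by rewrite kE pfactorK // logn_prime // eqxx leq_subLR.
have /cycleP[k kE] : [~ t, g]%g \in <[z]>%g.
  by apply: (subsetP (der1_min nz abq)); apply: mem_commg.
by exists k; rewrite -kE; apply: commgC.
Qed.

Hypothesis noE : ~ (exists2 D : {group {perm X}}, D \in Dset &
  exists2 E : {group {perm X}}, E \subset D & p.-abelem E && (#|E| == p ^ 2)%N).

(** A p-group of order at least p^2 contains a subgroup of order p^2, elementary abelian since [G]
    has exponent p; [noE] excludes it. *)
Lemma Dset_cyclic (D : {group {perm X}}) : D \in Dset -> exists2 g, g \in G & D :=: <[g]>%g.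
Proof.
move=> DD; have sDG := sub_Dset DD; have pD := pgroupS sDG pG.
suff /cyclicP[g gE] : cyclic D by exists g; rewrite // -cycle_subG -gE.
have [k kE] := p_natP pD.
have [k2|k2] := leqP 2 k; last first.
  case: k k2 kE => [|[|//]] _ kE; last by apply: prime_cyclic; rewrite kE expn1.
  by move/eqP: kE; rewrite expn0 -trivg_card1 => /eqP ->; apply: cyclic1.
have [|E [sED _ cE]] := normal_pgroup (r := 2) pD (normal_refl D).
  by rewrite kE pfactorK.
case: noE; exists D => //; exists E => //; rewrite cE eqxx andbT.
rewrite abelemE // (card_p2group_abelian pr cE) /=.
by apply: dvdn_trans eG; apply: exponentS; apply: subset_trans sDG.
Qed.

Lemma commutatorD f1 f2 : commutator_value z t F (cochain_of G x0 (cochain2_add f1 f2)) =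
  commutator_value z t F (cochain_of G x0 f1) + commutator_value z t F (cochain_of G x0 f2).
Proof. by rewrite /commutator_value !cochain_ofD; ring. Qed.

(** The map is p times the commutator value, an integer by [commutator_p], reduced modulo p; it
    vanishes exactly when the commutator value is integral, that is, on coboundaries. *)
Lemma sha_iso : sha_iso_Zp G H p Dset.
Proof.
have p1 := prime_gt1 pr.
pose cv f := commutator_value z t F (cochain_of G x0 f).
have pcv f : sha_cocycle G H Dset f -> p%:R * cv f \is a Num.int.
  by move=> [fc _]; apply: (commutator_p pr cd); apply: cochain_of_cocycle1 fc.
exists (fun f => (Num.floor (p%:R * cv f))%:~R); split.
- move=> f1 f2 s1 s2; rewrite -rmorphD /=; congr (_%:~R).
  have E : p%:R * cv (cochain2_add f1 f2) = p%:R * cv f1 + p%:R * cv f2.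
    by rewrite /cv commutatorD mulrDr.
  by rewrite E; apply: (@intr_inj rat); rewrite rmorphD /= !floorK ?rpredD ?pcv.
- move=> a; pose s : rat := (a : nat)%:R / p%:R.
  have p0 : p%:R != 0 :> rat by rewrite pnatr_eq0 -lt0n prime_gt0.
  have psE : p%:R * s = (a : nat)%:R by rewrite /s mulrC divfK.
  have ps : p%:R * s \is a Num.int by rewrite psE natr_int.
  pose m := quad_cocycle i j c e s.
  have mc : cocycle1 G m by apply: (quad_cocycle1 pr cd p2 et comm_z ps).
  have mf : agrees_on_fix G m by apply: (quad_agrees cd et comm_z s).
  have [f fc [phi phiE]] := cochain_of_surj tr HE mc.
  have cvf : cv f = s.
    rewrite /cv -(commutator_twist cd _ phi) -(quad_commutator pr cd et s) -/m.
    have h1 := phiE t tG (z (F 0 0)) (F 0 0); have h2 := phiE z zG (t (F 0 0)) (F 0 0).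
    by rewrite /commutator_value; lra.
  exists f; last first.
    rewrite cvf psE -[(a : nat)%:R]/((a : nat)%:Z%:~R) intrKfloor -pmulrn.
    exact: natr_Zp.
  split=> // D DD; have sDG := sub_Dset DD.
  apply/(coboundary_cochain_of tr HE sDG fc).
  apply/(coboundary1_twist _ _ phi); apply: (@coboundary1_eq _ D m).
    by move=> g /(subsetP sDG) gG x y; have := phiE g gG x y; lra.
  (* [D] is generated by an element with trivial p-th power, so agreement on fixed points suffices
     for local triviality. *)
  have [g gG DE] := Dset_cyclic DD.
  have := coboundary1_prime_cycle pr mc gG (expp gG) (fun x y => @mf g x y gG).
  by apply: coboundary1S; rewrite DE.
- move=> f shf; have [fc fD] := shf; have mc := cochain_of_cocycle1 tr HE fc.
  have mf := sha_agrees cyc_Dset shf.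
  rewrite (coboundary_cochain_of tr HE (subxx G) fc); split.
    by move/(floor_int_Zp_eq0 p1 (pcv f shf)); apply: (commutator_coboundary pr cd mc mf).
  by move/(coboundary_commutator cd) => h; apply/(floor_int_Zp_eq0 p1 (pcv f shf)).
Qed.

End Small.
End WithCoordinates.
End Main.

Local Close Scope ring_scope.

Theorem theorem4p14 (p : nat) (G H : {group {perm 'I_(p ^ 2)}}) (i0 : 'I_(p ^ 2)) :
  prime p -> (2 < p)%N ->
  [transitive G, on [set: 'I_(p ^ 2)] | 'P] ->
  H :=: 'C_G[i0 | 'P] ->
  p.-group G ->
  (~ sha_trivial G H (cyclic_subgroups G) ->
     exists2 n : nat, (n == 1)%N || (n == 2)%N & G \isog Pprime p n)
  /\
  (forall n : nat, (n == 1)%N || (n == 2)%N -> G \isog Pprime p n ->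
   forall Dset : {set {group {perm 'I_(p ^ 2)}}}, admissible G Dset ->
     ((exists2 D : {group {perm 'I_(p ^ 2)}}, D \in Dset &
         exists2 E : {group {perm 'I_(p ^ 2)}}, E \subset D & p.-abelem E && (#|E| == p ^ 2)%N)
        -> sha_trivial G H Dset)
     /\
     (~ (exists2 D : {group {perm 'I_(p ^ 2)}}, D \in Dset &
         exists2 E : {group {perm 'I_(p ^ 2)}}, E \subset D & p.-abelem E && (#|E| == p ^ 2)%N)
        -> sha_iso_Zp G H p Dset)).
Proof.
move=> pr p2 tr HE pG; have cX : #|'I_(p ^ 2)| = (p ^ 2)%N by rewrite card_ord.
have [z [t [i [j [c [e [F [cd [F00 et]]]]]]]]] := coordinates_exist i0 pr pG tr cX.
split=> [nt|n n12 iso Dset aD].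
  have [/orP[]|no] := boolP ((G \isog Pprime p 1) || (G \isog Pprime p 2)).
  - by exists 1%N.
  - by exists 2.
  by case: nt; apply: (sha_cyclic_trivial pr p2 tr HE pG cX cd F00 no).
have eG : (exponent G %| p)%N by rewrite (exponent_isog iso) Pprime_exponent.
have cG3 : (#|G| <= p ^ 3)%N.
  rewrite (card_isog iso); case/orP: n12 => /eqP ->; last by rewrite card_Pprime2.
  by rewrite card_Pprime1 // leq_exp2l // prime_gt1.
have et0 a : e t a = 0%R.
  by apply: et; move/exponentP: eG; apply; apply: coord_t cd.
split=> [[D DD [E sED /andP[abE /eqP cE]]]|noE].
  exact: (sha_trivial_abelem pr tr HE cX cd F00 cG3 aD DD sED abE cE).
exact: (sha_iso pr p2 tr HE pG cd eG cG3 et0 aD noE).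
Qed.
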